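(* Let $T$ be a binary search tree with $n$ vertices, labeled by $1,\dots,n$ according to the in-order algorithm, and let $\trianglelefteq_T$ be the associated partial order on $\{1,\dots,n\}$. Construct a graded quiver $Q$ as follows. (i) The vertices of $Q$ are $1,2,\dots,n$. (ii) There is an edge between $i$ and $j$ if and only if $i$ and $j$ label a set of vertices of $T$ of the form $\{v,\ell(v)\}$ or $\{v,r(v)\}$. If $i$ labels $\ell(v)$ and $j$ labels $v$, the edge is an arrow $\varepsilon_i^j: i\to j$ of degree $1$. If $i$ labels $r(v)$ and $j$ labels $v$, the edge is an arrow $f_i^j: i\to j$ of degree $0$. Let $I\subset KQ$ be the ideal generated by all products $f_j^k\varepsilon_i^j$ and all products $\varepsilon_j^k\varepsilon_i^j$ (for all $i,j,k$ for which these arrows exist). Then there is an isomorphism of graded algebras $$KQ/I\;\cong\;\operatorname{Ext}_{A_n}^\ast(\Delta,\Delta),$$ where $\Delta=\bigoplus_{i=1}^n\Delta(i)$ is the direct sum of the standard modules of $(A_n,\trianglelefteq_T)$.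
   Context: $K$ is an algebraically closed field and $A_n$ is the path algebra over $K$ of the quiver $1\to 2\to\cdots\to n$ with arrows $\alpha_i:i\to i+1$. Modules are finite-dimensional left modules and paths are composed from right to left ($\beta\alpha$ means first $\alpha$, then $\beta$); likewise, in $\operatorname{Ext}_{A_n}^\ast(\Delta,\Delta)=\bigoplus_{k\ge 0}\operatorname{Ext}^k_{A_n}(\Delta,\Delta)$ the product $xy$ is the Yoneda product ''first $y$, then $x$''. $L(i)$ is the simple module at vertex $i$ and $P(i)$ its projective cover. A binary tree is either empty or a triple consisting of a root and two binary trees, its left and right subtrees. The in-order algorithm labels the $n$ vertices by $1,\dots,n$ by recursively visiting the left subtree, then the root, then the right subtree; thus labels in the left (right) subtree of the vertex labeled $k$ are smaller (greater) than $k$. For a vertex $v$, $\ell(v)$ and $r(v)$ denote its left and right child (if they exist). The partial order $\trianglelefteq_T$ is: $i\triangleleft_T j$ iff $i$ labels a vertex in the left or right subtree of the vertex labeled $j$. The standard module $\Delta(i)$ is the largest quotient of $P(i)$ all of whose composition factors $L(j)$ satisfy $j\trianglelefteq_T i$. The algebra $A_n$ is quasi-hereditary with respect to $\trianglelefteq_T$. The grading on $KQ$ is induced by the degrees of the arrows, trivial paths having degree $0$. *)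

(* Defs.v *)
From HB Require Import structures.
From mathcomp Require Import all_boot all_order all_algebra.
From mathcomp Require Import ring_quotient generic_quotient.
From mathcomp Require Import finmap boolp.
From mathcomp.multinomials Require Import monalg.

Set Implicit Arguments.
Unset Strict Implicit.
Unset Printing Implicit Defensive.

Import GRing.Theory.
Local Open Scope ring_scope.
Local Open Scope quotient_scope.
Local Obligation Tactic := idtac.

(* Associative unital K-algebras, given by a ring with a central ring morphism
   from K.  The library's algType excludes the zero algebra, whereas KQ/I and
   Ext^*(M, M) are zero for the empty tree. *)
HB.mixin Record isPzAlgebra (K : pzRingType) A of GRing.PzRing A := {
  scal : K -> A;
  scal_zmod_morphism : zmod_morphism scal;
  scal_monoid_morphism : monoid_morphism scal;
  scalC : forall (k : K) (x : A), scal k * x = x * scal k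
}.
#[short(type="pzAlgType")]
HB.structure Definition PzAlgebra (K : pzRingType) :=
  {A of GRing.PzRing A & isPzAlgebra K A}.

HB.instance Definition _ (K : pzRingType) (A : pzAlgType K) :=
  GRing.isZmodMorphism.Build K A (@scal K A) scal_zmod_morphism.
HB.instance Definition _ (K : pzRingType) (A : pzAlgType K) :=
  GRing.isMonoidMorphism.Build K A (@scal K A) scal_monoid_morphism.

Definition surj (X Y : Type) (f : X -> Y) : Prop := forall y, exists x, f x = y.

(* gA k and gB k are the homogeneous components of degree k. *)
Definition graded_alg_iso (K : pzRingType) (A B : pzAlgType K)
    (gA : nat -> A -> Prop) (gB : nat -> B -> Prop) : Prop :=
  exists f : {rmorphism A -> B},
    [/\ bijective f, forall c : K, f (scal c) = scal c
      & forall k x, gA k x <-> gB k (f x)].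

Section QuotientAlgebra.
Variables (K : pzRingType) (A : pzAlgType K) (G : A -> Prop).

Definition two_sided_ideal (J : A -> Prop) : Prop :=
  [/\ J 0, forall x y, J x -> J y -> J (x - y)
    & forall a x b, J x -> J (a * x * b)].

Definition ideal_gen : {pred A} := fun x =>
  `[< forall J, two_sided_ideal J -> (forall z, G z -> J z) -> J x >].

Lemma ideal_genP : two_sided_ideal (fun x => x \in ideal_gen).
Proof.
split; first by apply/asboolP => J [].
- move=> x y /asboolP Jx /asboolP Jy; apply/asboolP => J idJ GJ.
  by case: (idJ) => _ + _; apply; [apply: Jx|apply: Jy].
- move=> a x b /asboolP Jx; apply/asboolP => J idJ GJ.
  by case: (idJ) => _ _; apply; apply: Jx.
Qed.

Fact ideal_gen_zmod_closed : zmod_closed ideal_gen.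
Proof. by case: ideal_genP => J0 JB _; split=> // x y; exact: JB. Qed.

HB.instance Definition _ := GRing.isZmodClosed.Build A ideal_gen
  ideal_gen_zmod_closed.

Lemma ideal_genMl a x : x \in ideal_gen -> a * x \in ideal_gen.
Proof. by case: ideal_genP => _ _ h /(h a _ 1); rewrite mulr1. Qed.

Lemma ideal_genMr x b : x \in ideal_gen -> x * b \in ideal_gen.
Proof. by case: ideal_genP => _ _ h /(h 1 _ b); rewrite mul1r. Qed.

Definition quotalg := Quotient.quot ideal_gen.
HB.instance Definition _ := GRing.Zmodule.on quotalg.

Definition qproj (x : A) : quotalg := \pi_(quotalg) x.

Lemma qproj_eq x y : (qproj x = qproj y) <-> (x - y \in ideal_gen).
Proof. by rewrite Quotient.idealrBE; split=> /eqP. Qed.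

Lemma qproj_surj u : exists x, u = qproj x.
Proof. by exists (repr u); rewrite /qproj reprK. Qed.

Lemma qprojD x y : qproj (x + y) = qproj x + qproj y.
Proof. by rewrite /qproj piE. Qed.

Definition qone : quotalg := qproj 1.
Definition qmul (u v : quotalg) : quotalg := qproj (repr u * repr v).
Definition qscal (k : K) : quotalg := qproj (scal k).

Lemma repr_qproj x : repr (qproj x) - x \in ideal_gen.
Proof. by apply/qproj_eq; rewrite /qproj reprK. Qed.

Lemma qmulE x y : qmul (qproj x) (qproj y) = qproj (x * y).
Proof.
apply/qproj_eq; set a := repr _; set b := repr _.
have -> : a * b - x * y = (a - x) * b + x * (b - y).
  by rewrite mulrBl mulrBr addrA subrK.
by apply: rpredD; [apply: ideal_genMr|apply: ideal_genMl]; exact: repr_qproj.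
Qed.

Fact qmulA : associative qmul.
Proof.
move=> u v w; have [x ->] := qproj_surj u; have [y ->] := qproj_surj v.
by have [z ->] := qproj_surj w; rewrite !qmulE mulrA.
Qed.
Fact qmul1 : left_id qone qmul.
Proof. by move=> u; have [x ->] := qproj_surj u; rewrite qmulE mul1r. Qed.
Fact q1mul : right_id qone qmul.
Proof. by move=> u; have [x ->] := qproj_surj u; rewrite qmulE mulr1. Qed.
Fact qmulDl : left_distributive qmul +%R.
Proof.
move=> u v w; have [x ->] := qproj_surj u; have [y ->] := qproj_surj v.
by have [z ->] := qproj_surj w; rewrite -qprojD !qmulE mulrDl qprojD.
Qed.
Fact qmulDr : right_distributive qmul +%R.
Proof.
move=> u v w; have [x ->] := qproj_surj u; have [y ->] := qproj_surj v.
by have [z ->] := qproj_surj w; rewrite -qprojD !qmulE mulrDr qprojD.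
Qed.
HB.instance Definition _ := GRing.Zmodule_isPzRing.Build quotalg
  qmulA qmul1 q1mul qmulDl qmulDr.

Fact qscal_zmod_morphism : zmod_morphism qscal.
Proof. by move=> a b; rewrite /qscal rmorphB /qproj piE. Qed.
Fact qscal_monoid_morphism : monoid_morphism qscal.
Proof.
split=> [|a b]; first by rewrite /qscal rmorph1.
by rewrite /GRing.mul /= qmulE /qscal rmorphM.
Qed.
Fact qscalC (k : K) (u : quotalg) : qscal k * u = u * qscal k.
Proof.
by have [x ->] := qproj_surj u; rewrite /GRing.mul /= !qmulE scalC.
Qed.
HB.instance Definition _ := isPzAlgebra.Build K quotalg
  qscal_zmod_morphism qscal_monoid_morphism qscalC.

End QuotientAlgebra.

Record quiver := Quiver {
  qvert : finType;
  qarr : finType;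
  qsrc : qarr -> qvert;
  qtgt : qarr -> qvert
}.

Section PathAlgebra.
Variables (K : fieldType) (Q : quiver).

Fixpoint is_walk (v : qvert Q) (s : seq (qarr Q)) : bool :=
  if s is a :: s' then (qsrc a == v) && is_walk (qtgt a) s' else true.

(* A path is its starting vertex with its arrows in order of traversal. *)
Definition qpath := {p : qvert Q * seq (qarr Q) | is_walk p.1 p.2}.
HB.instance Definition _ := Choice.on qpath.

Definition psrc (p : qpath) : qvert Q := (val p).1.
Definition parrows (p : qpath) : seq (qarr Q) := (val p).2.
Definition ptgt (p : qpath) : qvert Q := last (psrc p) (map (@qtgt Q) (parrows p)).

Definition ptriv (v : qvert Q) : qpath := Sub (v, [::]) isT.
Fact parr_subproof (a : qarr Q) : is_walk (qsrc a) [:: a].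
Proof. by rewrite /= eqxx. Qed.
Definition parr (a : qarr Q) : qpath := Sub (qsrc a, [:: a]) (parr_subproof a).

Lemma is_walk_cat v s t :
  is_walk v (s ++ t) = is_walk v s && is_walk (last v (map (@qtgt Q) s)) t.
Proof. by elim: s v => //= a s IH v; rewrite IH andbA. Qed.

(* pcomp q p is "first p, then q". *)
Definition pcomp (q p : qpath) : option qpath :=
  if ptgt p == psrc q
  then (insub (psrc p, parrows p ++ parrows q) : option qpath) else None.

Definition pathalg := {malg K[qpath]}.
HB.instance Definition _ := GRing.Lmodule.on pathalg.

Definition pelt (p : qpath) : pathalg := << p >>.
Definition pmul_basis (q p : qpath) : pathalg :=
  if pcomp q p is Some r then pelt r else 0.
Definition pmul (x y : pathalg) : pathalg :=
  \sum_(q <- msupp x) \sum_(p <- msupp y) (x@_q * y@_p) *: pmul_basis q p.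
Definition pone : pathalg := \sum_(v : qvert Q) pelt (ptriv v).

Lemma pmulw (d e : {fset qpath}) x y : (msupp x `<=` d)%fset ->
  (msupp y `<=` e)%fset -> pmul x y =
  \sum_(q <- d) \sum_(p <- e) (x@_q * y@_p) *: pmul_basis q p.
Proof.
move=> sd se; rewrite /pmul (big_fset_incl _ sd) /=.
  apply: eq_bigr => q _; apply: big_fset_incl => // p _ /mcoeff_outdom ->.
  by rewrite mulr0 scale0r.
by move=> q _ /mcoeff_outdom qx; rewrite big1 // => p _; rewrite qx mul0r scale0r.
Qed.

Fact pmulDl : left_distributive pmul +%R.
Proof.
move=> x y z; set d := (msupp x `|` msupp y)%fset.
rewrite (@pmulw d (msupp z)) ?msuppD_le ?fsubset_refl //.
rewrite (@pmulw d (msupp z)) ?fsubsetUl ?fsubset_refl //.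
rewrite (@pmulw d (msupp z) y) ?fsubsetUr ?fsubset_refl // -big_split /=.
apply: eq_bigr => q _; rewrite -big_split /=; apply: eq_bigr => p _.
by rewrite mcoeffD mulrDl scalerDl.
Qed.

Fact pmulDr : right_distributive pmul +%R.
Proof.
move=> z x y; set d := (msupp x `|` msupp y)%fset.
rewrite (@pmulw (msupp z) d) ?msuppD_le ?fsubset_refl //.
rewrite (@pmulw (msupp z) d) ?fsubsetUl ?fsubset_refl //.
rewrite (@pmulw (msupp z) d _ y) ?fsubsetUr ?fsubset_refl // -big_split /=.
apply: eq_bigr => q _; rewrite -big_split /=; apply: eq_bigr => p _.
by rewrite mcoeffD mulrDr scalerDl.
Qed.

Lemma pmul0l y : pmul 0 y = 0.
Proof. by apply: (addrI (pmul 0 y)); rewrite -pmulDl !addr0. Qed.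
Lemma pmul0r y : pmul y 0 = 0.
Proof. by apply: (addrI (pmul y 0)); rewrite -pmulDr !addr0. Qed.

Lemma pmulZl k x y : pmul (k *: x) y = k *: pmul x y.
Proof.
rewrite (@pmulw (msupp x) (msupp y)) ?msuppZ_le ?fsubset_refl // /pmul.
rewrite scaler_sumr; apply: eq_bigr => q _; rewrite scaler_sumr.
by apply: eq_bigr => p _; rewrite mcoeffZ scalerA mulrA.
Qed.
Lemma pmulZr k x y : pmul x (k *: y) = k *: pmul x y.
Proof.
rewrite (@pmulw (msupp x) (msupp y)) ?msuppZ_le ?fsubset_refl // /pmul.
rewrite scaler_sumr; apply: eq_bigr => q _; rewrite scaler_sumr.
by apply: eq_bigr => p _; rewrite mcoeffZ scalerA mulrCA.
Qed.

Lemma pmul_suml (I : Type) (r : seq I) (F : I -> pathalg) y :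
  pmul (\sum_(i <- r) F i) y = \sum_(i <- r) pmul (F i) y.
Proof. by rewrite (big_morph (pmul^~ y) (fun a b => pmulDl a b y) (pmul0l y)). Qed.
Lemma pmul_sumr (I : Type) (r : seq I) (F : I -> pathalg) y :
  pmul y (\sum_(i <- r) F i) = \sum_(i <- r) pmul y (F i).
Proof. by rewrite (big_morph (pmul y) (fun a b => pmulDr y a b) (pmul0r y)). Qed.

Lemma pmul_pelt q p : pmul (pelt q) (pelt p) = pmul_basis q p.
Proof.
rewrite (@pmulw [fset q]%fset [fset p]%fset) ?msuppU_le //.
by rewrite !big_seq_fset1 !mcoeffUU mul1r scale1r.
Qed.

Lemma pathalgE (x : pathalg) : x = \sum_(p <- msupp x) x@_p *: pelt p.
Proof.
rewrite {1}[x]monalgE; apply: eq_bigr => p _; apply/malgP => r.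
by rewrite mcoeffZ !mcoeffU mulr_natr.
Qed.

Lemma pcompE q p r : pcomp q p = Some r <->
  ptgt p = psrc q /\ val r = (psrc p, parrows p ++ parrows q).
Proof.
rewrite /pcomp; case: eqP => [e|ne]; last by split=> // -[].
split=> [|[_ <-]]; last by rewrite valK.
by case: insubP => // u _ uE [<-].
Qed.

Lemma pcomp_ex q p : ptgt p = psrc q -> exists r, pcomp q p = Some r.
Proof.
move=> e; rewrite /pcomp e eqxx; case: insubP => [u _ _|]; first by exists u.
rewrite /= is_walk_cat (valP p) /=; move: e; rewrite /ptgt => ->.
by rewrite (valP q).
Qed.

Lemma pcomp_None q p : ptgt p <> psrc q -> pcomp q p = None.
Proof. by rewrite /pcomp => /eqP/negPf ->. Qed.

Lemma pcomp_src q p r : pcomp q p = Some r -> psrc r = psrc p.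
Proof. by move/pcompE=> [_ e]; rewrite /psrc e. Qed.
Lemma pcomp_arrows q p r : pcomp q p = Some r -> parrows r = parrows p ++ parrows q.
Proof. by move/pcompE=> [_ e]; rewrite /parrows e. Qed.
Lemma pcomp_tgt q p r : pcomp q p = Some r -> ptgt r = ptgt q.
Proof.
move=> e; rewrite /ptgt (pcomp_src e) (pcomp_arrows e) map_cat last_cat.
by move/pcompE: e => [+ _]; rewrite /ptgt => ->.
Qed.

Lemma pmul_basisA a b c :
  pmul (pelt a) (pmul_basis b c) = pmul (pmul_basis a b) (pelt c).
Proof.
have [e1|n1] := eqVneq (ptgt c) (psrc b); last first.
  rewrite {1}/pmul_basis (pcomp_None (elimN eqP n1)) pmul0r.
  rewrite /pmul_basis; case E: (pcomp a b) => [r|]; last by rewrite pmul0l.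
  rewrite pmul_pelt /pmul_basis pcomp_None //.
  by rewrite (pcomp_src E); apply/eqP.
have [r Er] := pcomp_ex e1; rewrite {1}/pmul_basis Er.
have [e2|n2] := eqVneq (ptgt b) (psrc a); last first.
  rewrite pmul_pelt /pmul_basis (@pcomp_None a b); last exact/eqP.
  by rewrite pmul0l pcomp_None // (pcomp_tgt Er); apply/eqP.
have [s Es] := pcomp_ex e2; rewrite {1}/pmul_basis Es !pmul_pelt /pmul_basis.
have /pcomp_ex [u Eu] : ptgt r = psrc a by rewrite (pcomp_tgt Er).
have /pcomp_ex [v Ev] : ptgt c = psrc s by rewrite (pcomp_src Es).
rewrite Eu Ev; congr pelt; apply: val_inj.
case/pcompE: Eu => _ ->; case/pcompE: Ev => _ ->.
by rewrite (pcomp_src Er) (pcomp_arrows Er) (pcomp_arrows Es) catA.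
Qed.

Lemma pmulEl x y : pmul x y = \sum_(p <- msupp x) x@_p *: pmul (pelt p) y.
Proof.
by rewrite {1}(pathalgE x) pmul_suml; apply: eq_bigr => p _; rewrite pmulZl.
Qed.
Lemma pmulEr x y : pmul x y = \sum_(p <- msupp y) y@_p *: pmul x (pelt p).
Proof.
by rewrite {1}(pathalgE y) pmul_sumr; apply: eq_bigr => p _; rewrite pmulZr.
Qed.

Fact pmulA : associative pmul.
Proof.
move=> x y z; rewrite [LHS]pmulEl (pmulEl x y) [RHS]pmul_suml.
apply: eq_bigr => a _; rewrite pmulZl; congr (_ *: _).
rewrite (pmulEl y z) (pmulEr (pelt a) y) [LHS]pmul_sumr [RHS]pmul_suml.
apply: eq_bigr => b _; rewrite pmulZl pmulZr; congr (_ *: _).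
rewrite (pmulEr _ z) [RHS]pmulEr [LHS]pmul_sumr.
apply: eq_bigr => c _; rewrite pmulZr; congr (_ *: _).
by rewrite !pmul_pelt pmul_basisA.
Qed.

Fact pmul1l : left_id pone pmul.
Proof.
move=> x; rewrite [LHS]pmulEr [RHS]pathalgE.
apply: eq_bigr => p _; congr (_ *: _).
rewrite /pone pmul_suml (bigD1 (ptgt p)) //= big1 ?addr0 => [|v nv].
  rewrite pmul_pelt /pmul_basis.
  have -> : pcomp (ptriv (ptgt p)) p = Some p; last by [].
  by apply/pcompE; rewrite cats0 /psrc /parrows; case: (val p).
by rewrite pmul_pelt /pmul_basis pcomp_None // => /esym/eqP; apply/negP.
Qed.

Fact pmul1r : right_id pone pmul.
Proof.
move=> x; rewrite [LHS]pmulEl [RHS]pathalgE.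
apply: eq_bigr => p _; congr (_ *: _).
rewrite /pone pmul_sumr (bigD1 (psrc p)) //= big1 ?addr0 => [|v nv].
  rewrite pmul_pelt /pmul_basis.
  have -> : pcomp p (ptriv (psrc p)) = Some p; last by [].
  by apply/pcompE; rewrite /psrc /parrows /=; case: (val p).
by rewrite pmul_pelt /pmul_basis pcomp_None // => /eqP; apply/negP.
Qed.

HB.instance Definition _ := GRing.Zmodule_isPzRing.Build pathalg
  pmulA pmul1l pmul1r pmulDl pmulDr.

Definition pscal (k : K) : pathalg := k *: pone.
Fact pscal_zmod_morphism : zmod_morphism pscal.
Proof. by move=> a b; rewrite /pscal scalerBl. Qed.
Fact pscal_monoid_morphism : monoid_morphism pscal.
Proof.
split=> [|a b]; first by rewrite /pscal scale1r.
by rewrite /GRing.mul /= /pscal pmulZl pmul1l scalerA.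
Qed.
Fact pscalC (k : K) (x : pathalg) : pscal k * x = x * pscal k.
Proof. by rewrite /GRing.mul /= /pscal pmulZl pmulZr pmul1l pmul1r. Qed.
HB.instance Definition _ := isPzAlgebra.Build K pathalg
  pscal_zmod_morphism pscal_monoid_morphism pscalC.

Definition pdeg (deg : qarr Q -> nat) (p : qpath) : nat :=
  (\sum_(a <- parrows p) deg a)%N.

Definition pathalg_gr (deg : qarr Q -> nat) (k : nat) (x : pathalg) : Prop :=
  forall p, p \in msupp x -> pdeg deg p = k.

End PathAlgebra.

(* The grading of KQ/I induced by that of KQ. *)
Definition quot_gr (K : fieldType) (Q : quiver) (deg : qarr Q -> nat)
    (G : pathalg K Q -> Prop) (k : nat) (u : quotalg G) : Prop :=
  exists x, pathalg_gr deg k x /\ u = qproj G x.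

Section Modules.
Variables (K : fieldType) (A : pzAlgType K).

Definition finite_dim (M : lmodType A) : Prop :=
  exists (m : nat) (v : 'I_m -> M), forall x, exists c : 'I_m -> K,
    x = \sum_(i < m) (scal (c i) : A) *: v i.

Record fdMod := FdMod { fdMod_sort :> lmodType A; fdModP : finite_dim fdMod_sort }.

Definition projective (P : fdMod) : Prop :=
  forall (U V : fdMod) (g : {linear U -> V}) (f : {linear P -> V}),
    surj g -> exists h : {linear P -> U}, forall x, g (h x) = f x.

Definition projective_cover (P S : fdMod) (c : {linear P -> S}) : Prop :=
  [/\ projective P, surj c
    & forall (X : fdMod) (h : {linear X -> P}), surj (c \o h) -> surj h].

(* For S simple: S is isomorphic to a subquotient of N. *)
Definition composition_factor (S N : fdMod) : Prop :=
  exists (V : fdMod) (i : {linear V -> N}) (p : {linear V -> S}),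
    injective i /\ surj p.

Definition largest_quotient (X : fdMod) (good : fdMod -> Prop) (D : fdMod)
    (q : {linear X -> D}) : Prop :=
  [/\ surj q, good D
    & forall (N : fdMod) (r : {linear X -> N}), surj r -> good N ->
      exists h : {linear D -> N}, forall x, h (q x) = r x].

Definition is_direct_sum (n : nat) (X : 'I_n -> fdMod) (D : fdMod) : Prop :=
  exists (inj : forall i, {linear X i -> D}) (prj : forall i, {linear D -> X i}),
    [/\ forall i x, prj i (inj i x) = x,
        forall i j x, i != j -> prj i (inj j x) = 0
      & forall y, y = \sum_(i < n) inj i (prj i y)].

Record resolution (M : fdMod) := Resolution {
  res :> nat -> fdMod;
  res_d : forall k, {linear res k.+1 -> res k};
  res_aug : {linear res 0 -> M};
  res_proj : forall k, projective (res k);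
  res_aug_surj : surj res_aug;
  res_exact0 : forall x, res_aug x = 0 <-> exists y, res_d 0 y = x;
  res_exact : forall k x, res_d k x = 0 <-> exists y, res_d k.+1 y = x
}.

End Modules.
Arguments res_proj {K A M} r k : rename.
Arguments res_aug_surj {K A M} r : rename.

Section LinearMaps.
Variables (R : pzRingType) (U V : lmodType R).

Definition mklin (f : U -> V) (fL : linear f) : {linear U -> V} :=
  HB.pack_for {linear U -> V} f (GRing.isLinear.Build R U V *:%R f fL).

Lemma lin_ext (f g : {linear U -> V}) : f =1 g -> f = g.
Proof.
case: f g => [f [[f1] [f2]]] [g [[g1] [g2]]] /= /funext e.
by move: f1 f2 g1 g2; rewrite e => *; congr GRing.Linear.Pack;
  congr GRing.Linear.Class; congr (_ _); exact: Prop_irrelevance.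
Qed.
End LinearMaps.

Fact scal_linear (K : pzRingType) (A : pzAlgType K) (c : K) (V : lmodType A) :
  linear (fun v : V => (scal c : A) *: v).
Proof. by move=> a u v; rewrite scalerDr !scalerA scalC. Qed.

Section Image.
Variables (R : pzRingType) (U V : lmodType R) (g : {linear U -> V}).

Definition img : {pred V} := fun v => `[< exists u, g u = v >].
Fact img_submod_closed : submod_closed img.
Proof.
split; first by apply/asboolP; exists 0; rewrite linear0.
move=> a v w /asboolP [x <-] /asboolP [y <-]; apply/asboolP.
by exists (a *: x + y); rewrite linearP.
Qed.
HB.instance Definition _ := GRing.isSubmodClosed.Build R V img img_submod_closed.

Definition imgT := {v : V | v \in img}.
HB.instance Definition _ := SubChoice.on imgT.
HB.instance Definition _ := [SubChoice_isSubLmodule of imgT by <:].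

Definition to_img (u : U) : imgT := Sub (g u) (asboolT (ex_intro _ u erefl)).
Fact to_img_linear : linear to_img.
Proof. by move=> a x y; apply: val_inj; rewrite /= !linearP. Qed.
HB.instance Definition _ := GRing.isLinear.Build R U imgT *:%R to_img to_img_linear.

Lemma to_img_surj : surj to_img.
Proof.
by move=> [v /[dup] /asboolP [u uv] vI]; exists u; apply: val_inj.
Qed.
End Image.

Section Ext.
Variables (K : fieldType) (A : pzAlgType K) (M : fdMod A) (P : resolution M).

Local Notation d := (res_d P).
Local Notation aug := (res_aug P).

Lemma aug_d x : aug (d 0 x) = 0.
Proof. by apply/res_exact0; exists x. Qed.
Lemma d_d k x : d k (d k.+1 x) = 0.
Proof. by apply/res_exact; exists x. Qed.

(* A cocycle of the complex (+)_k Hom_A(P_k, M); coc k is its component of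
   degree k. *)
Record cocycle := Cocycle {
  coc :> forall k, {linear P k -> M};
  coc_fin : exists N, forall k, (N <= k)%N -> forall x, coc k x = 0;
  coc_d : forall k x, coc k (d k x) = 0
}.

Lemma cocycleP (x y : cocycle) : (forall k v, x k v = y k v) -> x = y.
Proof.
case: x y => [x x1 x2] [y y1 y2] /= e.
have {}e : x = y by apply: functional_extensionality_dep => k; exact: lin_ext.
by move: x1 x2; rewrite e => *; congr Cocycle; exact: Prop_irrelevance.
Qed.

HB.instance Definition _ := gen_eqMixin cocycle.
HB.instance Definition _ := gen_choiceMixin cocycle.

Program Definition coc0 : cocycle := @Cocycle (fun k => \0 : {linear P k -> M}) _ _.
Next Obligation. by exists 0. Qed.
Next Obligation. by []. Qed.

Program Definition cocD (x y : cocycle) : cocycle :=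
  @Cocycle (fun k => x k \+ y k : {linear P k -> M}) _ _.
Next Obligation.
move=> x y; have [m xm] := coc_fin x; have [n yn] := coc_fin y.
exists (m + n)%N => k le v /=; rewrite xm ?yn ?addr0 //.
- exact: leq_trans (leq_addl _ _) le.
- exact: leq_trans (leq_addr _ _) le.
Qed.
Next Obligation. by move=> x y k v /=; rewrite !coc_d addr0. Qed.

Program Definition cocN (x : cocycle) : cocycle :=
  @Cocycle (fun k => \- x k : {linear P k -> M}) _ _.
Next Obligation.
by move=> x; have [m xm] := coc_fin x; exists m => k le v /=; rewrite xm ?oppr0.
Qed.
Next Obligation. by move=> x k v /=; rewrite coc_d oppr0. Qed.

Fact cocDA : associative cocD.
Proof. by move=> x y z; apply: cocycleP => k v /=; rewrite addrA. Qed.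
Fact cocDC : commutative cocD.
Proof. by move=> x y; apply: cocycleP => k v /=; rewrite addrC. Qed.
Fact coc0D : left_id coc0 cocD.
Proof. by move=> x; apply: cocycleP => k v /=; rewrite add0r. Qed.
Fact cocND : left_inverse coc0 cocN cocD.
Proof. by move=> x; apply: cocycleP => k v /=; rewrite addNr. Qed.
HB.instance Definition _ := GRing.isZmodule.Build cocycle cocDA cocDC coc0D cocND.

Lemma cocDE (x y : cocycle) k v : (x + y) k v = x k v + y k v. Proof. by []. Qed.
Lemma cocBE (x y : cocycle) k v : (x - y) k v = x k v - y k v. Proof. by []. Qed.
Lemma coc0E k v : (0 : cocycle) k v = 0. Proof. by []. Qed.

Definition is_coboundary (x : cocycle) : Prop :=
  (forall v, x 0 v = 0) /\
  exists g : forall k, {linear P k -> M}, forall k v, x k.+1 v = g k (d k v).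
Definition coboundary : {pred cocycle} := fun x => `[< is_coboundary x >].

Fact coboundary_zmod_closed : zmod_closed coboundary.
Proof.
split.
  by apply/asboolP; split=> //; exists (fun k => \0 : {linear P k -> M}).
move=> x y /asboolP [x0 [g xg]] /asboolP [y0 [h yh]]; apply/asboolP; split.
  by move=> v; rewrite cocBE x0 y0 subr0.
exists (fun k => g k \- h k : {linear P k -> M}) => k v.
by rewrite cocBE xg yh.
Qed.
HB.instance Definition _ := GRing.isZmodClosed.Build cocycle coboundary
  coboundary_zmod_closed.

(* Ext^*(M, M) = (+)_k H^k(Hom_A(P, M)), computed with the projective resolution
   P of M; its product is defined below by lifting cocycles along P. *)
Definition ext := Quotient.quot coboundary.
HB.instance Definition _ := GRing.Zmodule.on ext.
Definition ext_class (x : cocycle) : ext := \pi_(ext) x.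

(* F collects one lift for each degree q: the maps F i (i + q) : P_(i+q) -> P_i,
   i >= 0, form a chain map lifting the degree q component P_q -> M of y. *)
Definition is_lift (y : cocycle) (F : forall i j, {linear P j -> P i}) : Prop :=
  [/\ forall j v, aug (F 0 j v) = y j v,
      forall i j v, d i (F i.+1 j.+1 v) = F i j (d j v),
      forall i j, (j < i)%N -> forall v, F i j v = 0
    & exists N, forall i j, (N + i <= j)%N -> forall v, F i j v = 0].

Lemma proj_lift (Q U V : fdMod A) (g : {linear U -> V}) (f : {linear Q -> V}) :
  projective Q -> (forall x, exists u, g u = f x) ->
  exists h : {linear Q -> U}, forall x, g (h x) = f x.
Proof.
move=> Qproj fg; have im_fd : finite_dim (imgT g : lmodType A).
  have [m [v vP]] := fdModP U; exists m, (fun i => to_img g (v i)) => w.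
  have [u <-] := to_img_surj w; have [c ->] := vP u; exists c.
  by rewrite linear_sum; apply: eq_bigr => i _; rewrite linearZ.
pose I := FdMod im_fd.
have f_lin : linear (fun x => Sub (f x) (asboolT (fg x)) : imgT g).
  by move=> a x y; apply: val_inj; rewrite /= !linearP.
have [h hP] := Qproj U I (to_img g) (mklin f_lin : {linear Q -> I}) (@to_img_surj _ _ _ g).
by exists h => x; have /(congr1 val) := hP x.
Qed.

Lemma lift_step i (r : forall j, {linear P j -> P i}) :
  (forall j v, exists z, d i z = r j (d j v)) ->
  (forall j, (j < i)%N -> forall v, r j v = 0) ->
  exists r' : forall j, {linear P j -> P i.+1},
    [/\ forall j v, d i (r' j.+1 v) = r j (d j v),
        forall j, (j < i.+1)%N -> forall v, r' j v = 0
      & forall j v, exists z, d i.+1 z = r' j (d j v)].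
Proof.
move=> rd r0.
have H j : exists h : {linear P j.+1 -> P i.+1},
    (forall v, d i (h v) = r j (d j v)) /\ ((j < i)%N -> forall v, h v = 0).
  have [ji|_] := boolP (j < i)%N.
    exists (\0 : {linear P j.+1 -> P i.+1}); split=> // v.
    by rewrite r0 //= linear0.
  have [h hP] := @proj_lift (P j.+1) (P i.+1) (P i) (d i)
    (r j \o d j : {linear P j.+1 -> P i}) (res_proj P j.+1) (rd j).
  by exists h.
pose h j := projT1 (cid (H j)); pose hP j := projT2 (cid (H j)).
pose r' j : {linear P j -> P i.+1} := match j return {linear P j -> P i.+1} with
  | 0 => \0 : {linear P 0 -> P i.+1} | j'.+1 => h j' end.
exists r'; split=> [j v|[|j] ji v|[|j] v] //=.
- by have [->] := hP j.
- by have [_ ->] := hP j.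
- by exists 0; rewrite linear0.
- by apply/res_exact; have [-> _] := hP j; rewrite d_d linear0.
Qed.

Lemma lift_exists y : exists F, is_lift y F.
Proof.
pose good i (r : forall j, {linear P j -> P i}) :=
  (forall j v, exists z, d i z = r j (d j v)) /\
  (forall j, (j < i)%N -> forall v, r j v = 0).
have H j : exists h : {linear P j -> P 0}, forall v, aug (h v) = y j v.
  by apply: proj_lift => [|x]; [exact: res_proj|exact: res_aug_surj].
pose r0 j := projT1 (cid (H j)).
have r0P j v : aug (r0 j v) = y j v by exact: (projT2 (cid (H j))).
have g0 : good 0 r0.
  by split=> // j v; apply/res_exact0; rewrite r0P coc_d.
have S i (r : {r | good i r}) :
    {r' | good i.+1 r' & forall j v, d i (r' j.+1 v) = projT1 r j (d j v)}.
  case: r => r [rd rz]; apply: cid2.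
  by have [r' [h1 h2 h3]] := lift_step rd rz; exists r'.
pose rows := nat_rect (fun i => {r | good i r}) (exist _ r0 g0)
  (fun i r => let: exist2 r' gr' _ := S i r in exist _ r' gr').
have [N yN] := coc_fin y.
pose F i j : {linear P j -> P i} :=
  if (N + i <= j)%N then \0 : {linear P j -> P i} else projT1 (rows i) j.
exists F; split=> [j v|i j v|i j ji v|].
- by rewrite /F addn0; case: leqP => [/yN ->|_]; rewrite ?linear0 //= r0P.
- rewrite /F addnS ltnS; case: leqP => _ /=; first by rewrite linear0.
  by case: (S i (rows i)) => r' gr' /= ->.
- rewrite /F leqNgt (leq_trans ji) ?leq_addl //=.
  by have [_ ->] := projT2 (rows i).
- by exists N => i j le v; rewrite /F le.
Qed.

Definition shift i (h : forall j, {linear P j -> P i}) j : {linear P j -> P i} :=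
  match j return {linear P j -> P i} with
  | 0 => \0 : {linear P 0 -> P i}
  | j'.+1 => h j' \o d j' : {linear P j'.+1 -> P i}
  end.

(* A lift of a coboundary is null-homotopic. *)
Lemma lift_null y F : is_lift y F -> is_coboundary y ->
  exists h : forall i j, {linear P j -> P i},
    forall i j v, d i (h i.+1 j v) = F i j v - shift (h i) j v.
Proof.
move=> [F1 F2 F3 _] [y0 [g yg]].
pose good i (h : forall j, {linear P j -> P i}) :=
  forall j v, exists z, d i z = F i j v - shift h j v.
have H j : exists h : {linear P j -> P 0}, forall v, aug (h v) = g j v.
  by apply: proj_lift => [|x]; [exact: res_proj|exact: res_aug_surj].
pose h0 j := projT1 (cid (H j)).
have h0P j v : aug (h0 j v) = g j v by exact: (projT2 (cid (H j))).
have g0 : good 0 h0.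
  move=> [|j] v; apply/res_exact0; rewrite linearB F1 /=.
    by rewrite y0 linear0 subr0.
  by rewrite yg h0P subrr.
have S i (h : {h | good i h}) :
    {h' | good i.+1 h' & forall j v, d i (h' j v) = F i j v - shift (projT1 h) j v}.
  case: h => h hg; apply: cid2 => /=.
  have H' j : exists h' : {linear P j -> P i.+1},
      forall v, d i (h' v) = F i j v - shift h j v.
    exact: (@proj_lift (P j) (P i.+1) (P i) (d i)
      (F i j \- shift h j : {linear P j -> P i}) (res_proj P j) (hg j)).
  pose h' j := projT1 (cid (H' j)).
  have h'P j v : d i (h' j v) = F i j v - shift h j v.
    exact: (projT2 (cid (H' j))).
  exists h' => // -[|j] v; apply/res_exact; rewrite linearB /=.
    by rewrite F3 // linear0 subrr.
  rewrite F2 h'P; case: j v => [|j] v /=; first by rewrite subr0 subrr.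
  by rewrite d_d linear0 subr0 subrr.
pose rows := nat_rect (fun i => {h | good i h}) (exist _ h0 g0)
  (fun i h => let: exist2 h' gh' _ := S i h in exist _ h' gh').
exists (fun i => projT1 (rows i)) => i j v /=.
by case: (S i (rows i)) => h' gh' /= ->.
Qed.

Lemma lift0 : is_lift 0 (fun i j => \0 : {linear P j -> P i}).
Proof. by split=> * //=; rewrite ?linear0 //; exists 0. Qed.

Lemma liftB y z F G : is_lift y F -> is_lift z G ->
  is_lift (y - z) (fun i j => F i j \- G i j : {linear P j -> P i}).
Proof.
move=> [F1 F2 F3 [m F4]] [G1 G2 G3 [n G4]]; split=> [j v|i j v|i j ji v|] /=.
- by rewrite linearB F1 G1.
- by rewrite linearB F2 G2.
- by rewrite F3 // G3 // subr0.
- exists (m + n)%N => i j le v; rewrite F4 ?G4 ?subr0 //.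
    by apply: leq_trans le; rewrite leq_add2r leq_addl.
  by apply: leq_trans le; rewrite leq_add2r leq_addr.
Qed.

(* The Yoneda product "first y, then x", where F lifts y: the component of
   degree m is the sum over i of x_i composed with F i m : P_m -> P_i. *)
Definition comp_lift_fun (x : cocycle) (F : forall i j, {linear P j -> P i})
    (m : nat) (v : P m) : M := \sum_(i < m.+1) x i (F i m v).

Fact comp_lift_linear x F m : linear (@comp_lift_fun x F m).
Proof.
move=> a u v; rewrite /comp_lift_fun scaler_sumr -big_split /=.
by apply: eq_bigr => i _; rewrite !linearP.
Qed.

Fact comp_lift_d x y F (m : nat) v : is_lift y F ->
  comp_lift_fun x F (d m v) = 0.
Proof.
move=> [_ F2 _ _]; rewrite /comp_lift_fun big1 // => i _.
by rewrite -F2 coc_d.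
Qed.

Fact comp_lift_fin x y F : is_lift y F ->
  exists N, forall m, (N <= m)%N -> forall v : P m, comp_lift_fun x F v = 0.
Proof.
move=> [_ _ _ [n F4]]; have [m xm] := coc_fin x.
exists (n + m)%N => k le v; rewrite /comp_lift_fun big1 // => i _.
have [mi|im] := leqP m i; first by rewrite xm.
by rewrite F4 ?linear0 //; apply: leq_trans le; rewrite leq_add2l ltnW.
Qed.

Definition comp_lift (x y : cocycle) F (Fy : is_lift y F) : cocycle :=
  @Cocycle (fun m => mklin (@comp_lift_linear x F m))
    (comp_lift_fin x Fy) (fun m v => comp_lift_d x v Fy).

Lemma comp_liftE x y F (Fy : is_lift y F) m v :
  comp_lift x Fy m v = \sum_(i < m.+1) x i (F i m v).
Proof. by []. Qed.

Lemma comp_lift_cobl x y F (Fy : is_lift y F) :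
  is_coboundary x -> is_coboundary (comp_lift x Fy).
Proof.
have [_ F2 _ _] := Fy; move=> [x0 [g xg]]; split=> [v|].
  by rewrite comp_liftE big_ord1 x0.
have L m : linear (fun v => \sum_(i < m.+1) g i (F i m v)).
  move=> a u v; rewrite scaler_sumr -big_split /=.
  by apply: eq_bigr => i _; rewrite !linearP.
exists (fun m => mklin (L m)) => m v.
rewrite comp_liftE big_ord_recl /= x0 add0r; apply: eq_bigr => i _.
by rewrite xg F2.
Qed.

Lemma comp_lift_cobr x y F (Fy : is_lift y F) :
  is_coboundary y -> is_coboundary (comp_lift x Fy).
Proof.
move=> /(lift_null Fy) [h hP].
have E m v : comp_lift x Fy m v = \sum_(i < m.+1) x i (shift (h i) m v).
  rewrite comp_liftE; apply: eq_bigr => i _.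
  by apply/eqP; rewrite -subr_eq0 -linearB -hP coc_d.
split=> [v|]; first by rewrite E big_ord1 /= linear0.
have L m : linear (fun v => \sum_(i < m.+2) x i (h i m v)).
  move=> a u v; rewrite scaler_sumr -big_split /=.
  by apply: eq_bigr => i _; rewrite !linearP.
by exists (fun m => mklin (L m)) => m v; rewrite E.
Qed.

Lemma ext_class_eq x y : (ext_class x = ext_class y) <-> is_coboundary (x - y).
Proof. by rewrite /ext_class; split=> [/eqP|h]; [|apply/eqP];
  rewrite -Quotient.idealrBE => *; apply/asboolP. Qed.

Lemma ext_classD x y : ext_class (x + y) = ext_class x + ext_class y.
Proof. by rewrite /ext_class piE. Qed.

Lemma ext_class_surj u : exists x, u = ext_class x.
Proof. by exists (repr u); rewrite /ext_class reprK. Qed.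

Lemma comp_lift_class x x' y y' F F' (Fy : is_lift y F) (Fy' : is_lift y' F') :
  ext_class x = ext_class x' -> ext_class y = ext_class y' ->
  ext_class (comp_lift x Fy) = ext_class (comp_lift x' Fy').
Proof.
move=> /ext_class_eq xx /ext_class_eq yy; apply/ext_class_eq.
have -> : comp_lift x Fy - comp_lift x' Fy' =
    comp_lift (x - x') Fy + comp_lift x' (liftB Fy Fy').
  apply: cocycleP => m v; rewrite cocBE cocDE !comp_liftE -sumrB -big_split.
  by apply: eq_bigr => i _; rewrite cocBE /= linearB addrA subrK.
have c1 : comp_lift (x - x') Fy \in coboundary.
  by apply/asboolP; apply: comp_lift_cobl.
have c2 : comp_lift x' (liftB Fy Fy') \in coboundary.
  by apply/asboolP; apply: comp_lift_cobr.
by have /asboolP := rpredD c1 c2.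
Qed.

Definition lift_of (y : cocycle) := projT1 (cid (lift_exists y)).
Definition lift_ofP (y : cocycle) : is_lift y (lift_of y) :=
  projT2 (cid (lift_exists y)).

Definition ext_mul (u v : ext) : ext :=
  ext_class (comp_lift (repr u) (lift_ofP (repr v))).

Lemma ext_mulE x y F (Fy : is_lift y F) :
  ext_mul (ext_class x) (ext_class y) = ext_class (comp_lift x Fy).
Proof. by apply: comp_lift_class; rewrite /ext_class reprK. Qed.

Lemma lift_comp y z F G (Fy : is_lift y F) (Gz : is_lift z G) :
  exists H, is_lift (comp_lift y Gz) H /\
    forall i m v, H i m v = \sum_(j < m.+1) F i j (G j m v).
Proof.
have L i m : linear (fun v => \sum_(j < m.+1) F i j (G j m v)).
  move=> a u v; rewrite scaler_sumr -big_split /=.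
  by apply: eq_bigr => j _; rewrite !linearP.
exists (fun i m => mklin (L i m)); split=> //.
have [F1 F2 F3 [n F4]] := Fy; have [G1 G2 G3 [p G4]] := Gz.
split=> [m v|i m v|i m mi v|] /=.
- by rewrite linear_sum /comp_lift_fun; apply: eq_bigr => j _; rewrite F1.
- rewrite big_ord_recl /= F3 // add0r linear_sum; apply: eq_bigr => j _.
  by rewrite F2 G2.
- by rewrite big1 // => j _; rewrite F3 //; apply: leq_trans mi.
- exists (n + p)%N => i m le v; rewrite big1 // => j _.
  have [nj|jn] := leqP (n + i) j; first exact: F4.
  rewrite G4 ?linear0 //; apply: leq_trans le.
  by rewrite addnAC [(p + _)%N]addnC leq_add2r ltnW.
Qed.

Fact ext_mulA : associative ext_mul.
Proof.
move=> u v w; have [x ->] := ext_class_surj u; have [y ->] := ext_class_surj v.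
have [z ->] := ext_class_surj w.
have [F Fy] := lift_exists y; have [G Gz] := lift_exists z.
have [H [Hyz HE]] := lift_comp Fy Gz.
rewrite (ext_mulE y Gz) (ext_mulE x Hyz) (ext_mulE x Fy) (ext_mulE _ Gz).
congr ext_class; apply: cocycleP => m t; rewrite !comp_liftE.
have [_ _ F3 _] := Fy.
under eq_bigr => i _ do rewrite HE linear_sum.
rewrite exchange_big; apply: eq_bigr => j _.
rewrite comp_liftE [in RHS](big_ord_widen m.+1
  (fun i => x i (F i j (G j m t))) (ltn_ord j)).
rewrite [RHS]big_mkcond /=; apply: eq_bigr => i _.
by case: ltnP => // ji; rewrite F3 ?linear0.
Qed.

Definition id_lift (c : K) i j : {linear P j -> P i} :=
  match @eqP _ j i with
  | ReflectT e => ecast i {linear P j -> P i} e (mklin (@scal_linear K A c (P j)))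
  | ReflectF _ => \0 : {linear P j -> P i}
  end.

Lemma id_lift_diag c i v : id_lift c i i v = (scal c : A) *: v.
Proof. by rewrite /id_lift; case: eqP => // e; rewrite (eq_axiomK e). Qed.

Lemma id_lift_neq c i j v : j != i -> id_lift c i j v = 0.
Proof. by rewrite /id_lift; case: eqP => // e; rewrite e eqxx. Qed.

(* The class of the cocycle c *: aug, in degree 0, is the image of c : K in Ext. *)
Definition coc_scal_fun (c : K) k : {linear P k -> M} :=
  match k return {linear P k -> M} with
  | 0 => mklin (@scal_linear K A c M) \o aug : {linear P 0 -> M}
  | k'.+1 => \0 : {linear P k'.+1 -> M}
  end.
Fact coc_scal_fin c :
  exists N, forall k, (N <= k)%N -> forall v, coc_scal_fun c k v = 0.
Proof. by exists 1%N; case. Qed.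
Fact coc_scal_d c k v : coc_scal_fun c k (d k v) = 0.
Proof. by case: k v => [|k] v //=; rewrite aug_d scaler0. Qed.
Definition coc_scal c := Cocycle (coc_scal_fin c) (coc_scal_d c).

Lemma id_liftP c : is_lift (coc_scal c) (id_lift c).
Proof.
split=> [[|j] v|i j v|i j ji v|].
- by rewrite id_lift_diag linearZ.
- by rewrite id_lift_neq // linear0.
- have [e|ne] := eqVneq j i; last by rewrite !id_lift_neq ?linear0.
  by subst j; rewrite !id_lift_diag linearZ.
- by rewrite id_lift_neq // neq_ltn ji.
- exists 1%N => i j le v; rewrite id_lift_neq // neq_ltn; apply/orP; right.
  by rewrite -add1n.
Qed.

Definition ext_scal (c : K) : ext := ext_class (coc_scal c).

Lemma ext_scalM c (x : cocycle) : exists y : cocycle, (forall m v, y m v = (scal c : A) *: x m v) /\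
  ext_mul (ext_scal c) (ext_class x) = ext_class y /\
  ext_mul (ext_class x) (ext_scal c) = ext_class y.
Proof.
exists (comp_lift x (id_liftP c)).
have E m v : comp_lift x (id_liftP c) m v = (scal c : A) *: x m v.
  rewrite comp_liftE big_ord_recr /= id_lift_diag linearZ big1 ?add0r // => i _.
  by rewrite id_lift_neq ?linear0 // neq_ltn (ltn_ord i) orbT.
split=> //; split; last exact: ext_mulE.
have [F Fx] := lift_exists x; rewrite (ext_mulE _ Fx); congr ext_class.
apply: cocycleP => m v; rewrite E comp_liftE big_ord_recl big1 ?addr0 //=.
by have [-> _ _ _] := Fx.
Qed.

Definition ext_one : ext := ext_scal 1.
Fact ext_mul1 : left_id ext_one ext_mul.
Proof.
move=> u; have [x ->] := ext_class_surj u.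
have [y [yE [-> _]]] := ext_scalM 1 x; congr ext_class.
by apply: cocycleP => m v; rewrite yE rmorph1 scale1r.
Qed.
Fact ext_1mul : right_id ext_one ext_mul.
Proof.
move=> u; have [x ->] := ext_class_surj u.
have [y [yE [_ ->]]] := ext_scalM 1 x; congr ext_class.
by apply: cocycleP => m v; rewrite yE rmorph1 scale1r.
Qed.
Fact ext_mulDl : left_distributive ext_mul +%R.
Proof.
move=> u v w; have [x ->] := ext_class_surj u; have [y ->] := ext_class_surj v.
have [z ->] := ext_class_surj w; have [F Fz] := lift_exists z.
rewrite -ext_classD !(ext_mulE _ Fz) -ext_classD; congr ext_class.
apply: cocycleP => m t; rewrite cocDE !comp_liftE -big_split.
by apply: eq_bigr.
Qed.
Fact ext_mulDr : right_distributive ext_mul +%R.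
Proof.
move=> w u v; have [x ->] := ext_class_surj u; have [y ->] := ext_class_surj v.
have [z ->] := ext_class_surj w.
have [F Fx] := lift_exists x; have [G Gy] := lift_exists y.
have Gz := liftB lift0 Gy; have Fz := liftB Fx Gz.
rewrite sub0r opprK in Fz.
rewrite -ext_classD (ext_mulE z Fx) (ext_mulE z Gy) (ext_mulE z Fz) -ext_classD.
congr ext_class; apply: cocycleP => m t; rewrite cocDE !comp_liftE -big_split.
by apply: eq_bigr => i _; rewrite /= sub0r opprK linearD.
Qed.
HB.instance Definition _ := GRing.Zmodule_isPzRing.Build ext
  ext_mulA ext_mul1 ext_1mul ext_mulDl ext_mulDr.

Fact ext_scal_zmod_morphism : zmod_morphism ext_scal.
Proof.
move=> a b; apply: (addIr (ext_scal b)); rewrite subrK -ext_classD.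
congr ext_class; apply: cocycleP => -[|k] v; rewrite cocDE /= ?addr0 //.
by rewrite rmorphB scalerBl subrK.
Qed.
Fact ext_scal_monoid_morphism : monoid_morphism ext_scal.
Proof.
split=> // a b; rewrite /GRing.mul /=.
have [y [yE [-> _]]] := ext_scalM a (coc_scal b); congr ext_class.
apply: cocycleP => -[|k] v; rewrite yE /= ?scaler0 //.
by rewrite scalerA rmorphM.
Qed.
Fact ext_scalC (c : K) (u : ext) : ext_scal c * u = u * ext_scal c.
Proof.
rewrite /GRing.mul /=; have [x ->] := ext_class_surj u.
by have [y [_ [-> ->]]] := ext_scalM c x.
Qed.
HB.instance Definition _ := isPzAlgebra.Build K ext
  ext_scal_zmod_morphism ext_scal_monoid_morphism ext_scalC.

Definition ext_gr (k : nat) (u : ext) : Prop :=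
  exists x : cocycle,
    (forall j, j != k -> forall v, x j v = 0) /\ u = ext_class x.

End Ext.

Section SimpleModules.
Variables (K : fieldType) (Q : quiver) (v : qvert Q).
Local Notation e := (ptriv v).

(* L(v) is K, on which e_v acts as the identity and every other path as 0. *)
Definition simple_at : Type := K.
HB.instance Definition _ := GRing.Zmodule.on simple_at.

Definition simple_scale (a : pathalg K Q) (x : simple_at) : simple_at := a@_e * x.

Lemma pmul_basis_ptriv (q p : qpath Q) :
  (pmul_basis K q p)@_e = ((q == e) && (p == e))%:R.
Proof.
have ext_e (p' : qpath Q) : psrc p' = v -> parrows p' = [::] -> p' = e.
  move=> s t; apply: val_inj.
  have -> : val p' = (psrc p', parrows p').
    by rewrite /psrc /parrows; case: (val p').
  by rewrite s t.
rewrite /pmul_basis; case E: (pcomp q p) => [r|]; last first.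
  rewrite mcoeff0; case: eqP => //= qe; case: eqP => // pe.
  have /pcomp_ex [r] : ptgt p = psrc q by rewrite qe pe.
  by rewrite E.
rewrite mcoeffU; congr (_%:R : K); congr nat_of_bool.
have [qe|qe] /= := eqVneq q e; last first.
  apply/eqP => re; case/eqP: qe.
  have := pcomp_arrows E; have := pcomp_tgt E; rewrite re /= => tE.
  rewrite {1}/parrows /= => /esym/(congr1 size)/eqP.
  rewrite size_cat addn_eq0 => /andP [_ /nilP q0]; apply: ext_e => //.
  by move: tE; rewrite {2}/ptgt q0.
have [pe|pe] := eqVneq p e.
  apply/eqP; apply: ext_e.
    by rewrite (pcomp_src E) pe.
  by rewrite (pcomp_arrows E) pe qe.
apply/eqP => re; case/eqP: pe.
have := pcomp_arrows E; have := pcomp_src E; rewrite re => sE.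
rewrite {1}/parrows /= => /esym/(congr1 size)/eqP.
by rewrite size_cat addn_eq0 => /andP [/nilP p0 _]; apply: ext_e.
Qed.

Lemma mcoeff_sum_ptriv (x : pathalg K Q) :
  \sum_(p <- msupp x) x@_p * (p == e)%:R = x@_e.
Proof.
rewrite [in RHS](pathalgE x) raddf_sum /=; apply: eq_bigr => p _.
by rewrite (mcoeffZ (K := qpath Q)) mcoeffU.
Qed.

Lemma mcoeff_mul_ptriv (x y : pathalg K Q) : (x * y)@_e = x@_e * y@_e.
Proof.
have -> : x * y = pmul x y by [].
rewrite /pmul raddf_sum /= -(mcoeff_sum_ptriv x) mulr_suml.
apply: eq_bigr => q _; rewrite raddf_sum /= -(mcoeff_sum_ptriv y) mulr_sumr.
apply: eq_bigr => p _; rewrite mcoeffZ pmul_basis_ptriv -mulnb natrM mulrACA.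
by [].
Qed.

Lemma mcoeff_one_ptriv : (1 : pathalg K Q)@_e = 1.
Proof.
have -> : (1 : pathalg K Q) = pone K Q by [].
rewrite /pone raddf_sum (bigD1 v) //= mcoeffUU big1 ?addr0 //.
move=> w wv; rewrite mcoeffU; case: eqP => // /(congr1 (@psrc Q)).
by rewrite /psrc /= => wE; rewrite wE eqxx in wv.
Qed.

Fact simple_scaleA a b x :
  simple_scale a (simple_scale b x) = simple_scale (a * b) x.
Proof. by rewrite /simple_scale mcoeff_mul_ptriv mulrA. Qed.
Fact simple_scale1 : left_id 1 simple_scale.
Proof. by move=> x; rewrite /simple_scale mcoeff_one_ptriv mul1r. Qed.
Fact simple_scaleDr : right_distributive simple_scale +%R.
Proof. by move=> a x y; rewrite /simple_scale mulrDr. Qed.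
Fact simple_scaleDl x : {morph simple_scale^~ x : a b / a + b}.
Proof. by move=> a b; rewrite /simple_scale mcoeffD mulrDl. Qed.
HB.instance Definition _ := GRing.Zmodule_isLmodule.Build (pathalg K Q) simple_at
  simple_scaleA simple_scale1 simple_scaleDr simple_scaleDl.

Fact simple_at_fd : finite_dim (simple_at : lmodType (pathalg K Q)).
Proof.
exists 1%N, (fun _ => 1 : K) => x; exists (fun _ => x).
rewrite big_ord1 /GRing.scale /= /simple_scale /scal /= /pscal mcoeffZ.
by rewrite mcoeff_one_ptriv !mulr1.
Qed.
Definition simple_mod : fdMod (pathalg K Q) := FdMod simple_at_fd.

End SimpleModules.

Inductive bintree := Leaf | Node of bintree & bintree.

Fixpoint nvert (T : bintree) : nat :=
  if T is Node l r then (nvert l + nvert r).+1 else 0%N.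

Inductive ltree := LLeaf | LNode of ltree & nat & ltree.

(* In-order labels are numbered from 0 rather than from 1: the vertex i : 'I_n
   stands for the label i + 1, in the tree as well as in the quivers. *)
Fixpoint inorder_from (m : nat) (T : bintree) : ltree :=
  if T is Node l r then
    LNode (inorder_from m l) (m + nvert l) (inorder_from (m + nvert l).+1 r)
  else LLeaf.
Definition inorder (T : bintree) : ltree := inorder_from 0 T.

Fixpoint has_label (t : ltree) (i : nat) : bool :=
  if t is LNode l x r then [|| x == i, has_label l i | has_label r i] else false.

Definition root_label (t : ltree) (i : nat) : bool :=
  if t is LNode _ x _ then x == i else false.

(* i labels the left (right) child of the vertex labelled j *)
Fixpoint is_lchild (t : ltree) (i j : nat) : bool :=
  if t is LNode l x r then
    [|| (x == j) && root_label l i, is_lchild l i j | is_lchild r i j]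
  else false.
Fixpoint is_rchild (t : ltree) (i j : nat) : bool :=
  if t is LNode l x r then
    [|| (x == j) && root_label r i, is_rchild l i j | is_rchild r i j]
  else false.

Fixpoint is_below (t : ltree) (i j : nat) : bool :=
  if t is LNode l x r then
    [|| (x == j) && (has_label l i || has_label r i), is_below l i j
      | is_below r i j]
  else false.

Definition tree_le (T : bintree) (i j : nat) : bool :=
  (i == j) || is_below (inorder T) i j.

Definition linear_quiver (n : nat) : quiver :=
  @Quiver 'I_n {a : 'I_n * 'I_n | a.1.+1 == a.2} (fun a => (val a).1)
    (fun a => (val a).2).

Definition An (K : fieldType) (n : nat) : pzAlgType K :=
  pathalg K (linear_quiver n).

Definition is_standard (K : fieldType) (n : nat) (T : bintree) (i : 'I_n)
    (D : fdMod (An K n)) : Prop :=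
  let L (j : 'I_n) : fdMod (An K n) := @simple_mod K (linear_quiver n) j in
  exists (P : fdMod (An K n)) (c : {linear P -> L i}) (q : {linear P -> D}),
    projective_cover c /\
    largest_quotient
      (fun N => forall j, composition_factor (L j) N -> tree_le T j i) q.

Arguments is_standard {K n} T i D.

Section TreeQuiver.
Variables (K : fieldType) (n : nat) (T : bintree).

Definition eps_arrow : finType :=
  {a : 'I_n * 'I_n | is_lchild (inorder T) a.1 a.2}.
Definition f_arrow : finType :=
  {a : 'I_n * 'I_n | is_rchild (inorder T) a.1 a.2}.

Definition tree_quiver : quiver :=
  @Quiver 'I_n (eps_arrow + f_arrow)%type
    (fun a => match a with inl e => (val e).1 | inr f => (val f).1 end)
    (fun a => match a with inl e => (val e).2 | inr f => (val f).2 end).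

Definition tree_deg (a : qarr tree_quiver) : nat :=
  match a with inl _ => 1%N | inr _ => 0%N end.

Definition eps_elt (e : eps_arrow) : pathalg K tree_quiver :=
  pelt K (parr (inl e : qarr tree_quiver)).
Definition f_elt (f : f_arrow) : pathalg K tree_quiver :=
  pelt K (parr (inr f : qarr tree_quiver)).

Definition tree_rel (z : pathalg K tree_quiver) : Prop :=
  (exists (e : eps_arrow) (f : f_arrow),
     (val e).2 = (val f).1 /\ z = f_elt f * eps_elt e) \/
  (exists e e' : eps_arrow,
     (val e).2 = (val e').1 /\ z = eps_elt e' * eps_elt e).

End TreeQuiver.

Arguments tree_rel K n T z : clear implicits.
Arguments tree_deg {n T} a.
Arguments quot_gr {K Q} deg G k u.
Arguments ext_gr {K A M} P k u.
Arguments graded_alg_iso {K A B} gA gB.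

(* Main.v *)
(* Write r(i) for the last label of the right subtree of the vertex i, so that
   Delta(i) = P(i)/P(r(i) + 1) is uniserial with factors L(i), ..., L(r(i)).
   From 0 -> P(r(i) + 1) -> P(i) -> Delta(i) -> 0 one reads off that
   Hom(Delta(i), Delta(j)) is K if j <= i and r(i) = r(j), and 0 otherwise, that
   Ext^1(Delta(i), Delta(j)) is K if j = r(i) + 1, and 0 otherwise, and that the
   higher Ext groups vanish.  The first condition says that i is reached from j
   by a chain of right children, the second one that j is reached from i by such
   a chain upwards followed by one step from a left child; so the basis elements
   of Ext are matched with the paths f ... f and eps f ... f, which are the paths
   outside I.  The projective covers of the Delta(i) add up to the regular module
   A, hence all cocycles of an arbitrary resolution P can be written through one
   map pi : P 0 -> A and multiplication by elements of A. *)
From HB Require Import structures.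
From mathcomp Require Import all_boot all_order all_algebra finmap.
From mathcomp Require Import boolp functions zify.
From mathcomp.multinomials Require Import monalg.
Require Import Defs.

Set Implicit Arguments.
Unset Strict Implicit.
Unset Printing Implicit Defensive.

Import GRing.Theory.
Local Open Scope ring_scope.

(** * Algebras with a triangular basis *)

(** The resolution P is arbitrary, so Ext cannot simply be computed from the two-term resolution.
    What helps is that Delta = A g is cyclic with a known annihilator: its endomorphisms are right
    multiplications, and a degree 1 cochain first divides an element of the annihilator by the path
    from l to r(l) + 1. Yoneda products then become products in A, because two lifts to A of the
    same map into Delta differ by elements annihilating g; a degree 1 class after a homomorphism
    also needs a correction by a coboundary. In the other direction, preimages y and z l in P of the
    generators of the two-term resolution give spanning sets, independence and the vanishing of
    higher Ext. The tree enters this computation only through r, whose intervals from i to r(i) are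
    nested. The record [interval_ext] separates the two halves: the module side knows nothing of
    trees, the quiver side nothing of modules. *)

(* A basis of A multiplied like the matrix units of lower triangular n x n
   matrices: elt i k, for i <= k < n, is the path from i to k, and
   elt i k = 0 for all other i, k. *)
Record tri_basis (K : fieldType) (A : pzAlgType K) (n : nat) := TriBasis {
  elt :> nat -> nat -> A;
  coef : A -> nat -> nat -> K;
  coefD : forall a b i k, coef (a + b) i k = coef a i k + coef b i k;
  coefZ : forall c a i k, coef (scal c * a) i k = c * coef a i k;
  coef_out : forall a i k, ~~ (i <= k < n)%N -> coef a i k = 0;
  coef_inj : forall a b,
    (forall i k, (i <= k < n)%N -> coef a i k = coef b i k) -> a = b;
  coef_elt : forall i k s t,
    coef (elt i k) s t = [&& i == s, k == t & (i <= k < n)%N]%:R;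
  eltM : forall i j j' k, (i <= j)%N -> (j' <= k)%N ->
    elt j' k * elt i j = if j == j' then elt i k else 0;
  elt_sum1 : \sum_(i < n) elt i i = 1
}.

Section TriangularBasis.
Variables (K : fieldType) (A : pzAlgType K) (n : nat) (q : tri_basis A n).
Local Notation co := (coef q).

Lemma coef0 i k : co 0 i k = 0.
Proof. by apply: (addrI (co 0 i k)); rewrite -coefD !addr0. Qed.

Lemma coefN a i k : co (- a) i k = - co a i k.
Proof. by apply: (addrI (co a i k)); rewrite -coefD !subrr coef0. Qed.

Lemma coefB a b i k : co (a - b) i k = co a i k - co b i k.
Proof. by rewrite coefD coefN. Qed.

Lemma coef_sum (I : Type) (s : seq I) (P : pred I) (F : I -> A) i k :
  co (\sum_(j <- s | P j) F j) i k = \sum_(j <- s | P j) co (F j) i k.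
Proof.
by apply: (big_morph (fun a => co a i k)) => [a b|]; rewrite ?coefD ?coef0.
Qed.

Lemma elt_out i k : ~~ (i <= k < n)%N -> q i k = 0.
Proof.
by move=> H; apply: (@coef_inj _ _ _ q) => s t _; rewrite coef_elt (negPf H) !andbF coef0.
Qed.

Lemma coef_expand a : a = \sum_(i < n) \sum_(k < n) scal (co a i k) * q i k.
Proof.
apply: (@coef_inj _ _ _ q) => s t /andP [st tn].
have sn := leq_ltn_trans st tn.
rewrite coef_sum (bigD1 (Ordinal sn)) //= [X in _ + X]big1 ?addr0; last first.
  move=> i ni; rewrite coef_sum big1 // => k _; rewrite coefZ coef_elt.
  by have /negPf -> : i != s :> nat by []; rewrite mulr0.
rewrite coef_sum (bigD1 (Ordinal tn)) //= [X in _ + X]big1 ?addr0; last first.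
  move=> k nk; rewrite coefZ coef_elt.
  by have /negPf -> : k != t :> nat by []; rewrite andbF mulr0.
by rewrite coefZ coef_elt !eqxx st tn mulr1.
Qed.

Lemma coef_mul_elt a i j s t :
  co (a * q i j) s t = if (s == i) && (i <= j < n)%N then co a j t else 0.
Proof.
have [H|H] := boolP (i <= j < n)%N; last first.
  by rewrite (elt_out H) mulr0 coef0 andbF.
rewrite andbT {1}(coef_expand a) mulr_suml coef_sum; case/andP: H => ij jn.
rewrite (bigD1 (Ordinal jn)) //= [X in _ + X]big1 ?addr0; last first.
  move=> l nl; rewrite mulr_suml coef_sum big1 // => k _.
  rewrite -mulrA coefZ; have [lk|lk] := leqP l k; last first.
    by rewrite [q l k]elt_out ?mul0r ?coef0 ?mulr0 // leqNgt lk.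
  rewrite eltM //; case: eqP => [e|_]; last by rewrite coef0 mulr0.
  by rewrite (_ : l = Ordinal jn) ?eqxx // in nl; apply: val_inj.
rewrite mulr_suml coef_sum.
have E (k : 'I_n) : co (scal (co a j k) * q j k * q i j) s t =
    if s == i then if (k == t :> nat) then co a j k else 0 else 0.
  rewrite -mulrA coefZ; have [jk|jk] := leqP j k; last first.
    by rewrite coef_out ?mul0r ?if_same // leqNgt jk.
  rewrite eltM // eqxx coef_elt (leq_trans ij jk) ltn_ord andbT eq_sym.
  by case: eqP; case: eqP; rewrite ?mulr0 ?mulr1.
under eq_bigr => k _ do rewrite E.
case: eqP => [_|_]; last by rewrite big1.
have [tn|tn] := ltnP t n.
  rewrite (bigD1 (Ordinal tn)) //= eqxx big1 ?addr0 // => k nk.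
  by case: eqP => // e; rewrite (_ : k = Ordinal tn) ?eqxx // in nk; apply: val_inj.
rewrite coef_out ?big1 // => [k _|]; last by rewrite andbC ltnNge tn.
by case: eqP => // e; have := ltn_ord k; rewrite e ltnNge tn.
Qed.

Lemma coefM a b s t :
  co (a * b) s t = \sum_(l < n) co b s l * co a l t.
Proof.
rewrite {1}(coef_expand b) mulr_sumr coef_sum.
have E (i : 'I_n) : co (a * \sum_(k < n) scal (co b i k) * q i k) s t =
    if s == i then \sum_(k < n) co b s k * co a k t else 0.
  rewrite mulr_sumr coef_sum; case: eqP => [e|ne].
    apply: eq_bigr => k _; rewrite mulrA -scalC -mulrA coefZ coef_mul_elt.
    rewrite {1}e eqxx /= ltn_ord andbT -e; case: leqP => // lt.
    by rewrite mulr0 [co b _ _]coef_out ?mul0r // leqNgt lt.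
  rewrite big1 // => k _; rewrite mulrA -scalC -mulrA coefZ coef_mul_elt.
  by move/eqP/negPf: ne => ->; rewrite mulr0.
under eq_bigr => i _ do rewrite E.
have [sn|sn] := ltnP s n.
  rewrite (bigD1 (Ordinal sn)) //= eqxx [X in _ + X]big1 ?addr0 // => i ni.
  by case: eqP => // e; rewrite (_ : i = Ordinal sn) ?eqxx // in ni; apply: val_inj.
have b0 l : co b s l = 0 by rewrite coef_out // andbC ltnNge; lia.
rewrite [RHS]big1 => [|l _]; last by rewrite b0 mul0r.
by rewrite big1 // => i _; case: eqP => // _; rewrite big1 // => k _; rewrite b0 mul0r.
Qed.

Lemma coef_elt_mul a i j s t :
  co (q i j * a) s t = if (t == j) && (i <= j < n)%N then co a s i else 0.
Proof.
rewrite coefM; have [/andP [ij jn]|H] := boolP (i <= j < n)%N; last first.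
  by rewrite andbF big1 // => l _; rewrite coef_elt (negPf H) !andbF mulr0.
rewrite andbT (bigD1 (Ordinal (leq_ltn_trans ij jn))) //= big1 ?addr0.
  by rewrite coef_elt eqxx ij jn andbT eq_sym; case: eqP; rewrite ?mulr0 ?mulr1.
move=> l nl; rewrite coef_elt; case: eqP => [e|]; rewrite ?mulr0 //.
by case/eqP: nl; apply: val_inj.
Qed.

Lemma coef1 s t : co 1 s t = ((s == t) && (t < n)%N)%:R.
Proof.
rewrite -(elt_sum1 q) coef_sum; have [tn|tn] := ltnP t n; last first.
  rewrite andbF big1 // => i _; rewrite coef_elt; case: eqP => //=.
  by case: eqP => // e; have := ltn_ord i; rewrite e ltnNge tn.
rewrite andbT (bigD1 (Ordinal tn)) //= big1 ?addr0 => [|i ni].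
  by rewrite coef_elt leqnn tn !andbT eqxx andbT eq_sym.
have /negPf ni' : i != t :> nat by [].
by rewrite coef_elt ni' andbF.
Qed.

Fact regular_fd : finite_dim (A^o : lmodType A).
Proof.
pose w := enum {: 'I_n * 'I_n}.
exists (size w), (fun j => q (tnth (in_tuple w) j).1 (tnth (in_tuple w) j).2) => a.
exists (fun j => co a (tnth (in_tuple w) j).1 (tnth (in_tuple w) j).2).
rewrite {1}(coef_expand a) pair_big /= -(big_tnth _ _ w xpredT
  (fun p => (scal (co a p.1 p.2) : A) * q p.1 p.2)).
by rewrite big_enum.
Qed.
Definition regular_mod : fdMod A := FdMod regular_fd.

End TriangularBasis.

(** * The path algebra of the linear quiver *)

Section LinearQuiverAlgebra.
Variables (K : fieldType) (n : nat).
Local Notation A := (An K n).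
Local Notation lpath := (qpath (linear_quiver n)).

Lemma lwalk_tgt (v : 'I_n) s : @is_walk (linear_quiver n) v s ->
  last v (map (@qtgt (linear_quiver n)) s) = (v + size s)%N :> nat.
Proof.
elim: s v => [|a s IH] v /=; first by rewrite addn0.
move=> /andP [/eqP av /IH ->]; rewrite addnS -addSn; congr (_ + _)%N.
by rewrite -av; have /eqP <- := valP a.
Qed.

Lemma larrow_inj (a b : qarr (linear_quiver n)) : qsrc a = qsrc b -> a = b.
Proof.
case: a b => [[a a'] /= aa] [[b b'] /= bb] /= ab; apply: val_inj => /=.
move/eqP: aa => aa; move/eqP: bb => bb; rewrite /= in aa bb.
by rewrite ab (_ : a' = b') //; apply: val_inj; rewrite /= -aa -bb ab.
Qed.

Lemma lwalk_inj (v : 'I_n) s t :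
  @is_walk (linear_quiver n) v s -> @is_walk (linear_quiver n) v t ->
  size s = size t -> s = t.
Proof.
elim: s v t => [|a s IH] v [|b t] //= /andP [/eqP av ws] /andP [/eqP bv wt] [st].
have ab : a = b := larrow_inj (etrans av (esym bv)).
by rewrite ab in ws *; rewrite (IH _ _ ws wt st).
Qed.

Lemma lpath_tgt (p : lpath) : ptgt p = (psrc p + size (parrows p))%N :> nat.
Proof. exact: lwalk_tgt (valP p). Qed.

(** A vertex has at most one outgoing arrow, so a walk is fixed by its start and its length, and the
    length is the difference of the end labels. *)
Lemma lpath_inj (p p' : lpath) :
  psrc p = psrc p' :> nat -> ptgt p = ptgt p' :> nat -> p = p'.
Proof.
move=> /val_inj s; rewrite !lpath_tgt s => /addnI t; apply: val_inj.
have := valP p; have := valP p'; move: s t; rewrite /psrc /parrows.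
by case: (val p) (val p') => [v w] [v' w'] /= <- t w1 w2; rewrite (lwalk_inj w2 w1 t).
Qed.

Definition joins (i k : nat) (p : lpath) : Prop :=
  psrc p = i :> nat /\ ptgt p = k :> nat.

Lemma joins_lt i k p : joins i k p -> (i <= k < n)%N.
Proof. by case=> <- <-; rewrite ltn_ord lpath_tgt leq_addr. Qed.

Lemma joins_ex i k : (i <= k < n)%N -> exists p, joins i k p.
Proof.
move=> /andP []; elim: k => [|k IH].
  by rewrite leqn0 => /eqP -> n0; exists (ptriv (Ordinal n0 : qvert (linear_quiver n))).
rewrite leq_eqVlt ltnS => /orP [/eqP -> kn|ik kn].
  by exists (ptriv (Ordinal kn : qvert (linear_quiver n))).
have [p [ps pt]] := IH ik (ltnW kn).
pose a : qarr (linear_quiver n) :=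
  exist (fun a : 'I_n * 'I_n => a.1.+1 == a.2)
    (Ordinal (ltnW kn), Ordinal kn) (eqxx _).
have /(@pcomp_ex (linear_quiver n) (parr a)) [r rE] : ptgt p = psrc (parr a).
  exact: val_inj.
by exists r; split; rewrite ?(pcomp_src rE) ?(pcomp_tgt rE).
Qed.

(** The path is picked by choice, which [lpath_inj] makes harmless; the default 0 lets [lpath_eltM]
    hold without upper bounds on the indices. *)
Definition lpath_elt (i k : nat) : A :=
  if pselect (exists p, joins i k p) is left h then pelt K (projT1 (cid h)) else 0.
Local Notation q := lpath_elt.

Definition lcoef (a : A) (i k : nat) : K :=
  if pselect (exists p, joins i k p) is left h
  then mcoeff (projT1 (cid h)) a else 0.
Local Notation co := lcoef.

Lemma pelt_lpath (p : lpath) : pelt K p = q (psrc p) (ptgt p).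
Proof.
rewrite /q; case: pselect => [h|[]]; last by exists p.
by case: cid => p' /= [s t]; congr pelt; apply: lpath_inj.
Qed.

Lemma lcoef_path (a : A) (p : lpath) : co a (psrc p) (ptgt p) = mcoeff p a.
Proof.
rewrite /co; case: pselect => [h|[]]; last by exists p.
by case: cid => p' /= [s t]; congr mcoeff; apply: lpath_inj.
Qed.

Lemma lpath_elt0 i k : ~~ (i <= k < n)%N -> q i k = 0.
Proof.
move=> H; rewrite /q; case: pselect => // h.
by have [p /joins_lt] := h; rewrite (negPf H).
Qed.

Lemma lcoef0 a i k : ~~ (i <= k < n)%N -> co a i k = 0.
Proof.
move=> H; rewrite /co; case: pselect => // h.
by have [p /joins_lt] := h; rewrite (negPf H).
Qed.

Lemma lcoef_zero i k : co 0 i k = 0.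
Proof. by rewrite /co; case: pselect => // h; rewrite mcoeff0. Qed.

Lemma lcoefD a b i k : co (a + b) i k = co a i k + co b i k.
Proof. by rewrite /co; case: pselect => [h|_]; rewrite ?mcoeffD ?addr0. Qed.

Lemma pathalg_scalE (Q : quiver) (c : K) (a : pathalg K Q) : scal c * a = c *: a.
Proof. by rewrite /scal /= /pscal /GRing.mul /= pmulZl pmul1l. Qed.

Lemma lcoefZ c a i k : co (scal c * a) i k = c * co a i k.
Proof.
by rewrite /co pathalg_scalE; case: pselect => [h|_]; rewrite ?mcoeffZ ?mulr0.
Qed.

Lemma lcoef_inj a b : (forall i k, (i <= k < n)%N -> co a i k = co b i k) -> a = b.
Proof.
move=> H; apply/malgP => p; rewrite -!lcoef_path; apply: H.
by apply: (@joins_lt _ _ p).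
Qed.

Lemma lcoef_elt i k s t : co (q i k) s t = [&& i == s, k == t & (i <= k < n)%N]%:R.
Proof.
have [H|H] := boolP (i <= k < n)%N; last by rewrite lpath_elt0 // lcoef_zero !andbF.
have [p [pi pk]] := joins_ex H.
have [H'|H'] := boolP (s <= t < n)%N; last first.
  rewrite lcoef0 //; case: eqP => //= is_; case: eqP => //= kt.
  by rewrite -is_ -kt H in H'.
have [p' [ps pt]] := joins_ex H'.
rewrite -ps -pt lcoef_path -pi -pk -pelt_lpath /pelt mcoeffU andbT.
congr (nat_of_bool _)%:R; apply/eqP/andP => [->|[/eqP e /eqP e']]; first by rewrite !eqxx.
exact: lpath_inj.
Qed.

Lemma lpath_eltM i j j' k : (i <= j)%N -> (j' <= k)%N ->
  q j' k * q i j = if j == j' then q i k else 0.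
Proof.
move=> ij jk; have [jn|jn] := boolP (j < n)%N; last first.
  rewrite (@lpath_elt0 i j) ?mulr0; last by rewrite (negPf jn) andbF.
  case: eqP => // jj; rewrite lpath_elt0 //; apply: contraNN jn => /andP [_].
  by apply: leq_trans; rewrite ltnS jj.
have [kn|kn] := boolP (k < n)%N; last first.
  rewrite [q j' k]lpath_elt0 ?mul0r; last by rewrite (negPf kn) andbF.
  by rewrite lpath_elt0 ?if_same // (negPf kn) andbF.
have [p [<- <-]] : exists p, joins i j p by apply: joins_ex; rewrite ij.
have [p' [<- <-]] : exists p, joins j' k p by apply: joins_ex; rewrite jk.
rewrite -!pelt_lpath [LHS]pmul_pelt /pmul_basis; case: eqP => [/val_inj e|ne].
  have [r rE] := @pcomp_ex (linear_quiver n) p' p e.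
  by rewrite rE pelt_lpath (pcomp_src rE) (pcomp_tgt rE).
by rewrite pcomp_None // => e; apply: ne; rewrite e.
Qed.

Lemma lpath_elt_sum1 : \sum_(i < n) q i i = 1.
Proof.
have -> : (1 : A) = pone K (linear_quiver n) by [].
by apply: eq_bigr => i _; rewrite pelt_lpath.
Qed.


Definition lpath_basis : tri_basis A n :=
  @TriBasis K A n lpath_elt lcoef lcoefD lcoefZ lcoef0 lcoef_inj lcoef_elt
    lpath_eltM lpath_elt_sum1.

End LinearQuiverAlgebra.

(** * Standard modules *)

Section LinearFactor.
Variables (R : pzRingType) (U V W : lmodType R).

Lemma lin_factor (g : {linear U -> V}) (f : {linear U -> W}) : surj g ->
  (forall u, g u = 0 -> f u = 0) ->
  exists h : {linear V -> W}, forall u, h (g u) = f u.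
Proof.
move=> gS gf; pose s v := projT1 (cid (gS v)).
have sP v : g (s v) = v by exact: projT2 (cid (gS v)).
have fE u u' : g u = g u' -> f u = f u'.
  by move=> e; apply/eqP; rewrite -subr_eq0 -linearB gf // linearB e subrr.
have L : linear (f \o s).
  by move=> a v w /=; rewrite -linearP; apply: fE; rewrite linearP !sP.
by exists (mklin L) => u /=; apply: fE; rewrite sP.
Qed.

Lemma orbit_linear (m : V) : linear (fun a : R^o => (a : R) *: m).
Proof. by move=> a b c; rewrite scalerDl scalerA. Qed.
Definition orbit_map (m : V) : {linear R^o -> V} := mklin (orbit_linear m).

End LinearFactor.

Section StandardModules.
Variables (K : fieldType) (A : pzAlgType K) (n : nat) (q : tri_basis A n).
Local Notation co := (coef q).

Lemma img_fd (U : fdMod A) (V : lmodType A) (g : {linear U -> V}) :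
  finite_dim (imgT g : lmodType A).
Proof.
have [m [v vP]] := fdModP U; exists m, (fun i => to_img g (v i)) => w.
have [u <-] := to_img_surj w; have [c ->] := vP u; exists c.
by rewrite linear_sum; apply: eq_bigr => i _; rewrite linearZ.
Qed.
Definition img_mod (U : fdMod A) (V : lmodType A) (g : {linear U -> V}) : fdMod A :=
  FdMod (img_fd g).

(* The direct sum of the uniserial modules with composition factors
   L(0), ..., L(m) and L(m + 1), ..., L(n - 1): one copy of K at each vertex,
   with all arrows acting as the identity except m -> m + 1, which acts as 0. *)
Definition cut_mod (m : nat) : Type := 'I_n -> K.
HB.instance Definition _ m := GRing.Zmodule.on (cut_mod m).
Definition cut_scale m (a : A) (f : cut_mod m) : cut_mod m :=
  fun k => \sum_(j < n) co a j k * ((j <= m) == (k <= m))%N%:R * f j.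
Fact cut_scaleA m a b (f : cut_mod m) :
  cut_scale a (cut_scale b f) = cut_scale (a * b) f.
Proof.
apply/funext => k; rewrite /cut_scale.
under eq_bigr => j _ do rewrite mulr_sumr.
rewrite exchange_big; apply: eq_bigr => l _; rewrite coefM !mulr_suml.
apply: eq_bigr => j _; rewrite !mulrA; congr (_ * _).
have [lj|lj] := leqP l j; last first.
  by rewrite (@coef_out _ _ _ q b) ?mulr0 ?mul0r // leqNgt lj.
have [jk|jk] := leqP j k; last first.
  by rewrite (@coef_out _ _ _ q a) ?mulr0 ?mul0r // leqNgt jk.
rewrite [co b l j * co a j k]mulrC -!mulrA; congr (_ * _).
rewrite mulrCA; congr (_ * _); rewrite -natrM mulnb.
(* For l <= j <= k, the ends l and k lie on the same side of the cut iff j lies there with both. *)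
by congr (nat_of_bool _)%:R; apply/idP/idP; lia.
Qed.
Fact cut_scale1 m : left_id 1 (@cut_scale m).
Proof.
move=> f; apply/funext => k; rewrite /cut_scale (bigD1 k) //= big1 ?addr0.
  by rewrite coef1 eqxx ltn_ord eqxx !mul1r.
by move=> j nj; rewrite coef1 (negPf (nj : j != k :> nat)) !mul0r.
Qed.
Fact cut_scaleDr m : right_distributive (@cut_scale m) +%R.
Proof.
move=> a f g; apply/funext => k; rewrite /cut_scale -[RHS]big_split /=.
by apply: eq_bigr => j _; rewrite -mulrDr.
Qed.
Fact cut_scaleDl m f : {morph (@cut_scale m)^~ f : a b / a + b}.
Proof.
move=> a b; apply/funext => k; rewrite /cut_scale -[RHS]big_split /=.
by apply: eq_bigr => j _; rewrite coefD !mulrDl.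
Qed.
HB.instance Definition _ m := GRing.Zmodule_isLmodule.Build A (cut_mod m)
  (@cut_scaleA m) (@cut_scale1 m) (@cut_scaleDr m) (@cut_scaleDl m).

Lemma cut_scaleE m (a : A) (f : cut_mod m) k :
  (a *: f) k = \sum_(j < n) co a j k * ((j <= m) == (k <= m))%N%:R * f j.
Proof. by []. Qed.

(** For i <= m < n its orbit is the uniserial module with factors L(i), ..., L(m), the concrete
    candidate for Delta(i). *)
Definition cut_delta m (i : 'I_n) : cut_mod m := fun k => (k == i)%:R.

Lemma cut_orbit m i a k :
  (a *: cut_delta m i) k = co a i k * ((i <= m) == (k <= m))%N%:R.
Proof.
rewrite cut_scaleE (bigD1 i) //= big1 ?addr0 => [|j nj]; rewrite /cut_delta.
  by rewrite eqxx mulr1.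
by rewrite (negPf nj) mulr0.
Qed.

(** A description of L(j) by the triangular basis alone, which keeps quivers out of the treatment of
    standard modules. *)
Definition simple_vertex (j : nat) (L : fdMod A) : Prop :=
  exists x : L, [/\ x <> 0, forall a, a *: x = (scal (co a j j) : A) *: x
    & forall y, exists c, y = (scal c : A) *: x].

Lemma scalK (M : lmodType A) (c : K) (x : M) :
  (scal c : A) *: x = 0 -> x <> 0 -> c = 0.
Proof.
move=> cx; have [//|c0] := eqVneq c 0; case.
by rewrite -[x]scale1r -(rmorph1 (@scal K A)) -(mulVf c0) rmorphM -scalerA cx scaler0.
Qed.

Lemma elt_idem j : q j j * q j j = q j j.
Proof. by rewrite eltM // eqxx. Qed.

Lemma elt_corner j a : q j j * a * q j j = scal (co a j j) * q j j.
Proof.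
apply: (@coef_inj _ _ _ q) => s t _.
rewrite coefZ coef_mul_elt coef_elt_mul coef_elt leqnn /=.
have [jn|jn] := ltnP j n; last by rewrite !andbF mulr0.
rewrite !andbT [j == s]eq_sym [j == t]eq_sym.
by case: (s == j); case: (t == j); rewrite ?mulr1 ?mulr0.
Qed.

(** The criterion is e_j N <> 0. Given a nonzero x in e_j N, the simple module is a quotient of A x:
    sending a *: x to a *: l is well defined, because e_j A e_j = K e_j turns a *: x = 0 into the
    vanishing of the coefficient of a at (j, j). *)
Lemma composition_factorP (j : 'I_n) (L N : fdMod A) : simple_vertex j L ->
  (composition_factor L N <-> exists2 x : N, q j j *: x = x & x <> 0).
Proof.
move=> [l [l0 lE lS]]; split=> [[V [i [p [iI pS]]]]|[x xj x0]].
  have [v pv] := pS l; exists (i (q j j *: v)).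
    by rewrite -linearZ scalerA elt_idem.
  rewrite -[0](linear0 i) => /iI e; apply: l0.
  rewrite -(linear0 p) -e linearZ pv /= lE coef_elt !eqxx leqnn ltn_ord.
  by rewrite rmorph1 scale1r.
have [p pE] : exists p : {linear img_mod (U := regular_mod q) (orbit_map x) -> L},
    forall a, p (to_img (orbit_map x) a) = orbit_map l a.
  apply: lin_factor; first exact: to_img_surj.
  move=> a /(congr1 val) /= ax0.
  rewrite lE (_ : co a j j = 0) ?rmorph0 ?scale0r //; apply: scalK x0.
  by rewrite -xj scalerA -elt_corner -!scalerA xj ax0 scaler0.
have vL : linear (val : imgT (orbit_map x) -> N) by move=> a u v; rewrite linearP.
exists (img_mod (U := regular_mod q) (orbit_map x)), (mklin vL), p; split.
  exact: val_inj.
by move=> y; have [c ->] := lS y; exists (to_img (orbit_map x) (scal c)); rewrite pE.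
Qed.

Lemma coef_corner (i : 'I_n) a s t :
  co (q i i * a) s t = if t == i then co a s i else 0.
Proof. by rewrite coef_elt_mul leqnn ltn_ord /= andbT. Qed.

(** The annihilator is bounded from two sides. The orbit of [cut_delta m i] is a good quotient of P,
    so D maps onto it; and in D a nonzero q i k *: p x with k > m would give the forbidden factor
    L(k). *)
Lemma standard_generator (L : 'I_n -> fdMod A) (good : 'I_n -> bool) (i : 'I_n)
    (m : nat) (P D : fdMod A) (c : {linear P -> L i}) (p : {linear P -> D}) :
  (forall j : 'I_n, simple_vertex j (L j)) -> (i <= m < n)%N ->
  (forall j : 'I_n, (i <= j)%N -> good j = (j <= m)%N) ->
  projective_cover c ->
  largest_quotient (fun N => forall j, composition_factor (L j) N -> good j) p ->
  exists g : D, surj (orbit_map g) /\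
    forall a, a *: g = 0 <-> forall k : nat, (i <= k <= m)%N -> co a i k = 0.
Proof.
move=> LS /andP [im mn] goodE [Pproj cS cmin] [pS Dgood Dmax].
have [l [l0 lE lS]] := LS i; have [x' cx'] := cS l; pose x := q i i *: x'.
have ix : q i i *: x = x by rewrite scalerA elt_idem.
have cx : c x = l.
  by rewrite linearZ cx' /= lE coef_elt !eqxx leqnn ltn_ord rmorph1 scale1r.
(* Minimality of the cover: A x already maps onto L(i), hence it is all of P. *)
have xS : surj (orbit_map x).
  apply: (cmin (regular_mod q)) => y /=; have [e ->] := lS y; exists (scal e : A).
  by rewrite linearZ /= cx.
(* A section of a |-> a *: x embeds P in A as the left ideal A b; maps out of P are then
   restrictions of orbit maps. *)
have [s sx] := Pproj (regular_mod q) P (orbit_map x) idfun xS.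
pose b : A := s x.
have bx : b *: x = x by exact: sx.
have bE : b = q i i * b by rewrite /b -{1}ix linearZ.
have bii : co b i i = 1.
  apply/eqP; rewrite -subr_eq0; apply/eqP; apply: scalK l0.
  rewrite rmorphB scalerBl -lE -cx -linearZ bx cx rmorph1 scale1r subrr.
  by [].
have bi k : co b i k = (k == i)%:R.
  by rewrite bE coef_corner; case: eqP.
pose N := img_mod (U := regular_mod q) (orbit_map (cut_delta m i)).
pose r : {linear P -> N} := to_img (orbit_map (cut_delta m i)) \o s.
have rx : val (r x) = cut_delta m i.
  apply/funext => k; rewrite /= -/b cut_orbit bi im /cut_delta.
  by rewrite -val_eqE /=; case: eqP => [->|_]; rewrite ?im ?mul1r ?mul0r.
have rS : surj r.
  move=> [f fN]; have /asboolP [a af] := fN; exists (a *: x); apply: val_inj.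
  by rewrite linearZ /= -[X in _ *: X]/(val (r x)) rx.
have Ngood j : composition_factor (L j) N -> good j.
  move/(composition_factorP _ (LS j)) => [y yj y0].
  have [f fE] : exists f : cut_mod m, f = val y by exists (val y).
  have fj : q j j *: f = f by rewrite fE -{2}yj.
  have fk k : f k = if k == j then f j else 0.
    rewrite -{1}fj cut_scaleE (bigD1 j) //= big1 ?addr0 => [|t nt].
      rewrite coef_elt eqxx leqnn ltn_ord andbT eq_sym -val_eqE.
      by case: eqP => [->|_]; rewrite ?eqxx ?mulr1 ?mul1r ?mul0r.
    by rewrite coef_elt eq_sym (negPf (nt : t != j :> nat)) !mul0r.
  have [a aE] : exists a, a *: cut_delta m i = f.
    by rewrite fE; case: (y) => z /= /asboolP.
  have fj0 : f j <> 0.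
    move=> fj0; apply: y0; apply: val_inj; rewrite /= -fE; apply/funext => k.
    by rewrite fk fj0 if_same.
  have [ij|ij] := leqP i j; last first.
    by case: fj0; rewrite -aE cut_orbit coef_out ?mul0r // leqNgt ij.
  rewrite goodE //; apply/negPn/negP => jm; case: fj0.
  by rewrite -aE cut_orbit im (negPf jm) mulr0.
have [h hp] := Dmax N r rS Ngood.
exists (p x); split=> [v|a].
  have [w <-] := pS v; have [a <-] := xS w; exists a.
  have pZ : p (a *: x) = a *: p x by rewrite linearZ.
  exact: esym pZ.
split=> [a0 k /andP [ik km]|a0].
  have ax : a *: cut_delta m i = 0.
    by rewrite -rx -[_ *: _]/(val (a *: r x)) -hp -linearZ a0 linear0.
  have kn := leq_ltn_trans km mn.
  have := congr1 (fun f => f (Ordinal kn)) ax.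
  by rewrite cut_orbit im km mulr1.
have qk (k : 'I_n) : (i <= k)%N -> (m < k)%N -> q i k *: p x = 0.
  move=> ik mk; case: (pselect (q i k *: p x = 0)) => // ne.
  have /Dgood : composition_factor (L k) D.
    apply/(composition_factorP _ (LS k)); exists (q i k *: p x) => //.
    by rewrite scalerA eltM // eqxx.
  by rewrite goodE // leqNgt mk.
rewrite -ix linearZ /= scalerA (coef_expand q (a * q i i)) scaler_suml.
rewrite big1 // => j _; rewrite scaler_suml big1 // => k _.
rewrite coef_mul_elt leqnn ltn_ord andbT.
case: eqP => [ji|_]; last by rewrite rmorph0 mul0r scale0r.
rewrite -scalerA; have [ik|ik] := leqP i k; last first.
  by rewrite coef_out ?rmorph0 ?scale0r // leqNgt ik.
have [km|km] := leqP k m; first by rewrite a0 ?ik // rmorph0 scale0r.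
by rewrite ji qk ?scaler0.
Qed.

(** The idempotents separate the generators, e_i g_i = g_i and e_i g_j = 0 otherwise, so the sum of
    the g_i generates M and its annihilator is described summand by summand. *)
Lemma sum_generator (r : nat -> nat) (D : 'I_n -> fdMod A) (M : fdMod A) :
  (forall i : 'I_n, i <= r i < n)%N -> is_direct_sum D M ->
  (forall i : 'I_n, exists g : D i, surj (orbit_map g) /\ forall a,
    a *: g = 0 <-> forall k : nat, (i <= k <= r i)%N -> co a i k = 0) ->
  exists g : M, surj (orbit_map g) /\ forall a, a *: g = 0 <->
    forall i k : nat, (i < n)%N -> (k <= r i)%N -> co a i k = 0.
Proof.
move=> rb [inj [prj [prjK prj0 sumE]]] H.
pose g i := projT1 (cid (H i)).
have gS i : surj (orbit_map (g i)) by have [] := projT2 (cid (H i)).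
have gE i : forall a, a *: g i = 0 <->
    forall k : nat, (i <= k <= r i)%N -> co a i k = 0.
  by have [] := projT2 (cid (H i)).
have qg (i j : 'I_n) : q i i *: g j = if i == j then g j else 0.
  have [<-|ij] := eqVneq.
    apply/eqP; rewrite -subr_eq0 -{2}[g i]scale1r -scalerBl; apply/eqP/gE => k _.
    rewrite coefB coef_elt coef1 eqxx leqnn ltn_ord andbT.
    by case: eqP => [<-|_]; rewrite ?ltn_ord subrr.
  by apply/gE => k _; rewrite coef_elt (negPf (ij : i != j :> nat)).
exists (\sum_i inj i (g i)); split=> [v|a].
  pose a i := projT1 (cid (gS i (prj i v))).
  have aE i : a i *: g i = prj i v by exact: projT2 (cid (gS i (prj i v))).
  exists (\sum_i a i * q i i); rewrite /= scaler_suml (sumE v).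
  apply: eq_bigr => i _; rewrite scaler_sumr (bigD1 i) //= big1 ?addr0.
    by rewrite -linearZ -scalerA qg eqxx aE.
  move=> j ji; rewrite -linearZ -scalerA qg eq_sym (negPf ji) scaler0.
  by rewrite linear0.
have prjE i : prj i (a *: \sum_j inj j (g j)) = a *: g i.
  rewrite linearZ /= linear_sum (bigD1 i) //= big1 ?addr0 ?prjK // => j ji.
  by rewrite prj0 // eq_sym.
split=> [a0 i k ilt kr|a0].
  have [ik|ik] := leqP i k; last by rewrite coef_out // leqNgt ik.
  have := prjE (Ordinal ilt); rewrite a0 linear0 => /esym /gE -> //.
  by rewrite /= ik.
rewrite (sumE (a *: _)) big1 // => i _; rewrite prjE (_ : a *: g i = 0) ?linear0 //.
by apply/gE => k /andP [_ kr]; apply: a0.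
Qed.

End StandardModules.

(** * Homogeneous classes in Ext *)

Section ExtClasses.
Variables (K : fieldType) (A : pzAlgType K) (M : fdMod A) (P : resolution M).
Local Notation d := (res_d P).
Local Notation aug := (res_aug P).

Definition at_deg k (f : {linear P k -> M}) j : {linear P j -> M} :=
  match @eqP _ k j with
  | ReflectT e => ecast j {linear P j -> M} e f
  | ReflectF _ => \0 : {linear P j -> M}
  end.

Lemma at_degE k f v : @at_deg k f k v = f v.
Proof. by rewrite /at_deg; case: eqP => // e; rewrite (eq_axiomK e). Qed.

Lemma at_deg_neq k f j v : k != j -> @at_deg k f j v = 0.
Proof. by rewrite /at_deg; case: eqP => // e; rewrite e eqxx. Qed.

Definition closed k (f : {linear P k -> M}) : Prop := forall v, f (d k v) = 0.

Lemma at_deg_fin k f : exists N, forall j, (N <= j)%N -> forall v, @at_deg k f j v = 0.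
Proof. by exists k.+1 => j kj v; rewrite at_deg_neq // neq_ltn kj. Qed.

Lemma at_deg_closed k f : closed f -> forall j v, @at_deg k f j (d j v) = 0.
Proof.
move=> fd j v; have [kj|kj] := eqVneq k j; last exact: at_deg_neq.
by subst j; rewrite at_degE fd.
Qed.

(** Extended by 0 to maps that are not cocycles, so that families indexed by all pairs of vertices
    are defined without closedness proofs. *)
Definition ext_of k (f : {linear P k -> M}) : ext P :=
  if pselect (closed f) is left h
  then ext_class (Cocycle (at_deg_fin f) (at_deg_closed h)) else 0.

Lemma ext_ofP k (f : {linear P k -> M}) : closed f ->
  exists2 x : cocycle P, ext_of f = ext_class x &
    (forall v, x k v = f v) /\ (forall j v, j != k -> x j v = 0).
Proof.
rewrite /ext_of; case: pselect => // h _; eexists; first by [].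
split=> [v|j v jk] /=; first by rewrite at_degE.
by rewrite at_deg_neq // eq_sym.
Qed.

Lemma coboundaryP (x : cocycle P) : is_coboundary x <->
  (forall v, x 0 v = 0) /\
  forall k, exists g : {linear P k -> M}, forall v, x k.+1 v = g (d k v).
Proof.
split=> [[x0 [g gx]]|[x0 H]]; split=> //; first by move=> k; exists (g k).
by exists (fun k => projT1 (cid (H k))) => k v; case: cid.
Qed.

Lemma ext_of_class k (f : {linear P k -> M}) (x : cocycle P) :
  (forall v, x k v = f v) -> (forall j v, j != k -> x j v = 0) ->
  ext_of f = ext_class x.
Proof.
move=> xf xj; have [|y -> [yf yj]] := @ext_ofP k f.
  by move=> v; rewrite -xf coc_d.
congr ext_class; apply: cocycleP => j v; have [jk|jk] := eqVneq j k.
  by subst j; rewrite yf xf.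
by rewrite yj ?xj.
Qed.

Lemma eq_ext_of k (f g : {linear P k -> M}) : f =1 g -> ext_of f = ext_of g.
Proof. by move=> /lin_ext ->. Qed.

Lemma ext_of_gr k (f : {linear P k -> M}) : ext_gr P k (ext_of f).
Proof.
have [h|h] := pselect (closed f).
  by have [x -> [_ xj]] := ext_ofP h; exists x; split=> // j jk v; apply: xj.
exists 0; split=> // ; rewrite /ext_of; case: pselect => // _.
by rewrite /ext_class piE.
Qed.

Lemma ext_grP k u : ext_gr P k u -> exists2 f : {linear P k -> M},
  closed f & u = ext_of f.
Proof.
move=> [x [xj ->]]; exists (x k); first by move=> v; rewrite coc_d.
by apply/esym/ext_of_class => // j v jk; apply: xj.
Qed.

Lemma ext_class0 : ext_class (0 : cocycle P) = 0.
Proof. by rewrite /ext_class piE. Qed.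

Lemma ext_of_exact k (f g : {linear P k.+1 -> M}) (h : {linear P k -> M}) :
  closed f -> closed g -> (forall v, f v - g v = h (d k v)) -> ext_of f = ext_of g.
Proof.
move=> fc gc fg; have [x -> [xf xj]] := ext_ofP fc.
have [y -> [yf yj]] := ext_ofP gc; apply/ext_class_eq/coboundaryP.
split=> [v|j]; first by rewrite cocBE xj ?yj ?subr0.
have [jk|jk] := eqVneq j k.
  by subst j; exists h => v; rewrite cocBE xf yf fg.
by exists (\0 : {linear P j -> M}) => v; rewrite cocBE xj ?yj ?subr0.
Qed.

Lemma ext_of_zero k (f : {linear P k -> M}) : (forall v, f v = 0) -> ext_of f = 0.
Proof.
by move=> f0; rewrite -ext_class0; apply: ext_of_class.
Qed.

Lemma ext_of_scal k (c : K) (f g : {linear P k -> M}) : closed f ->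
  (forall v, g v = (scal c : A) *: f v) -> ext_of g = scal c * ext_of f.
Proof.
move=> fc gE; have [x -> [xf xj]] := ext_ofP fc.
have [y [yE [h _]]] := ext_scalM c x; rewrite [RHS]h.
by apply: ext_of_class => [v|j v jk]; rewrite yE ?xf ?gE // xj // scaler0.
Qed.

Lemma ext_ofD k (f g h : {linear P k -> M}) : closed f -> closed g ->
  (forall v, h v = f v + g v) -> ext_of h = ext_of f + ext_of g.
Proof.
move=> fc gc hE; have [x -> [xf xj]] := ext_ofP fc.
have [y -> [yg yj]] := ext_ofP gc; rewrite -ext_classD.
by apply: ext_of_class => [v|j v jk]; rewrite cocDE ?xf ?yg ?hE // xj // yj // addr0.
Qed.

Lemma ext_of_sum (I : Type) (s : seq I) (c : I -> K) k
    (F : I -> {linear P k -> M}) (f : {linear P k -> M}) :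
  (forall i, c i <> 0 -> closed (F i)) ->
  (forall v, f v = \sum_(i <- s) (scal (c i) : A) *: F i v) ->
  ext_of f = \sum_(i <- s) scal (c i) * ext_of (F i).
Proof.
move=> Fc; elim: s f => [|i s IH] f fE.
  by rewrite big_nil; apply: ext_of_zero => v; rewrite fE big_nil.
have L (c' : K) (g : {linear P k -> M}) : linear (fun v => (scal c' : A) *: g v).
  by move=> a u v; rewrite linearP; apply: scal_linear.
have Ls : linear (fun v => \sum_(i <- s) (scal (c i) : A) *: F i v).
  move=> a u v; rewrite scaler_sumr -big_split /=.
  by apply: eq_bigr => j _; rewrite (L (c j) (F j)).
have cl j v : (scal (c j) : A) *: F j (d k v) = 0.
  have [->|/eqP /Fc ->] := eqVneq (c j) 0; last by rewrite scaler0.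
  by rewrite rmorph0 scale0r.
rewrite big_cons -(IH (mklin Ls)) // (@ext_ofD k (mklin (L (c i) (F i))) (mklin Ls)).
- congr (_ + _); have [ci|/eqP ci] := eqVneq (c i) 0; last first.
    exact: ext_of_scal (Fc _ ci) _.
  rewrite [RHS](_ : _ = 0); last by rewrite ci rmorph0 mul0r.
  by apply: ext_of_zero => v /=; rewrite ci rmorph0 scale0r.
- by move=> v /=; rewrite cl.
- by move=> v /=; rewrite big1 // => j _; rewrite cl.
- by move=> v; rewrite fE big_cons.
Qed.

(* A homogeneous cocycle of degree l has a chain lift homogeneous of degree l. *)
Lemma ext_of_mul k l (f : {linear P k -> M}) (g : {linear P l -> M}) :
  closed f -> closed g ->
  exists F : forall i, {linear P (i + l)%N -> P i},
    [/\ forall v, aug (F 0 v) = g v,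
        forall i v, d i (F i.+1 v) = F i (d (i + l)%N v)
      & closed (f \o F k : {linear P (k + l)%N -> M}) /\
        ext_of f * ext_of g = ext_of (f \o F k : {linear P (k + l)%N -> M})].
Proof.
move=> fc gc; have [x -> [xf xj]] := ext_ofP fc.
have [y -> [yf yj]] := ext_ofP gc.
have [F [F1 F2 F3 [N F4]]] := lift_exists y.
pose G i j : {linear P j -> P i} :=
  if j == (i + l)%N then F i j else \0 : {linear P j -> P i}.
have Gy : is_lift y G.
  split=> [j v|i j v|i j ji v|].
  - rewrite /G add0n; case: eqP => [_|/eqP jl]; first by rewrite F1.
    by rewrite linear0 yj.
  - by rewrite /G addSn eqSS; case: eqP; rewrite ?F2 ?linear0.
  - by rewrite /G; case: eqP => // _; rewrite F3.
  - by exists N => i j le v; rewrite /G; case: eqP => // _; rewrite F4.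
exists (fun i => F i (i + l)%N); split=> [v|i v|].
- by rewrite F1 yf.
- by rewrite F2.
split=> [v /=|]; first by rewrite -F2 fc.
rewrite [LHS](ext_mulE x Gy); apply/esym/ext_of_class => [v|j v jkl].
  rewrite comp_liftE (bigD1 (inord k)) //= inordK ?ltnS ?leq_addr // big1.
    by rewrite addr0 /G eqxx xf.
  move=> i ik; rewrite xj //; apply: contra ik => /eqP ik.
  by apply/eqP/val_inj; rewrite /= inordK // ltnS leq_addr.
rewrite comp_liftE big1 // => i _; have [ik|ik] := eqVneq (i : nat) k.
  by rewrite /G ik (negPf jkl) linear0.
by rewrite xj.
Qed.

Lemma ext_of1 : ext_of aug = 1.
Proof.
apply: ext_of_class => [v|[|j] v] //.
by rewrite /= rmorph1 scale1r.
Qed.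

Lemma ext_of_add_eq0 (f : {linear P 0 -> M}) (h : {linear P 1 -> M}) :
  closed f -> closed h -> ext_of f + ext_of h = 0 ->
  (forall v, f v = 0) /\ exists u : {linear P 0 -> M}, forall v, h v = u (d 0 v).
Proof.
move=> fc hc; have [x -> [xf xj]] := ext_ofP fc; have [w -> [wf wj]] := ext_ofP hc.
rewrite -ext_classD -ext_class0 => /ext_class_eq /coboundaryP [H0 /(_ 0%N) [u H1]].
split=> [v|]; first by have := H0 v; rewrite cocBE cocDE xf wj // addr0 subr0.
by exists u => v; have := H1 v; rewrite cocBE cocDE xj // wf add0r subr0.
Qed.

Lemma ext_gr0 k : ext_gr P k 0.
Proof. by exists 0; split=> //; rewrite ext_class0. Qed.

Lemma ext_grD k u v : ext_gr P k u -> ext_gr P k v -> ext_gr P k (u + v).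
Proof.
move=> [x [xj ->]] [w [wj ->]]; exists (x + w); rewrite ext_classD; split=> // j jk t.
by rewrite cocDE xj // wj // addr0.
Qed.

Lemma ext_grZ k c u : ext_gr P k u -> ext_gr P k (scal c * u).
Proof.
move=> [x [xj ->]]; have [w [wE [h _]]] := ext_scalM c x; exists w; split=> // j jk t.
by rewrite wE xj // scaler0.
Qed.

(** Cocycles have finite support, so their components are peeled off from the top degree
    downwards. *)
Lemma ext_gr_ind (S : ext P -> Prop) : S 0 -> (forall u v, S u -> S v -> S (u + v)) ->
  (forall k u, ext_gr P k u -> S u) -> forall u, S u.
Proof.
move=> S0 SD Sgr u; have [x ->] := ext_class_surj u; have [N] := coc_fin x.
elim: N x => [|N IH] x xN.
  suff -> : x = 0 by rewrite ext_class0.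
  by apply: cocycleP => k v; rewrite xN.
pose w := Cocycle (at_deg_fin (x N)) (at_deg_closed (fun v => coc_d x v)).
have -> : x = (x - w) + w by rewrite subrK.
rewrite ext_classD; apply: SD.
  apply: IH => k Nk v; rewrite cocBE /=; have [Ek|nk] := eqVneq N k.
    by subst k; rewrite at_degE subrr.
  by rewrite at_deg_neq // xN ?subr0 // ltn_neqAle nk.
apply: (Sgr N); exists w; split=> // j jN v; rewrite /= at_deg_neq //.
by rewrite eq_sym.
Qed.

End ExtClasses.

(** * The Ext algebra of the standard modules *)

(* The structure of the Ext algebra of a sum of modules Delta(i) with composition
   factors L(i), ..., L(r i): hom i j spans Hom(Delta(i), Delta(j)) when this is
   nonzero, and shift l spans Ext^1(Delta(l), Delta(r l + 1)). *)
Record interval_ext (K : fieldType) (n : nat) (r : nat -> nat)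
    (same_end : nat -> nat -> bool) (B : pzAlgType K) (gr : nat -> B -> Prop) := {
  hom : 'I_n -> 'I_n -> B;
  shift : 'I_n -> B;
  gr_zero : forall k, gr k 0;
  gr_add : forall k u v, gr k u -> gr k v -> gr k (u + v);
  gr_scal : forall k c u, gr k u -> gr k (scal c * u);
  gr_ind : forall S : B -> Prop, S 0 -> (forall u v, S u -> S v -> S (u + v)) ->
    (forall k u, gr k u -> S u) -> forall u, S u;
  gr_hom : forall i j, gr 0 (hom i j);
  gr_shift : forall l, gr 1 (shift l);
  hom_sum1 : \sum_i hom i i = 1;
  hom_orth : forall i j, i <> j -> hom i i * hom j j = 0;
  homM : forall i j k : 'I_n, same_end i j -> same_end j k ->
    hom j k * hom i j = hom i k;
  shift_hom : forall i j : 'I_n, same_end i j -> shift j * hom i j = shift i;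
  hom_shift : forall l k j : 'I_n, k = (r l).+1 :> nat -> same_end k j ->
    hom k j * shift l = if k == j then shift l else 0;
  shift_shift : forall l m, shift l * shift m = 0;
  gr0_span : forall u, gr 0%N u -> exists c : 'I_n * 'I_n -> K,
    (forall p, c p <> 0 -> same_end p.1 p.2) /\
    u = \sum_p scal (c p) * hom p.1 p.2;
  gr1_span : forall u, gr 1%N u -> exists c : 'I_n -> K,
    (forall l, c l <> 0 -> ((r l).+1 < n)%N) /\ u = \sum_l scal (c l) * shift l;
  gr_ge2 : forall k u, gr k.+2 u -> u = 0;
  hom_shift_free : forall (I : Type) (s : seq I) (c e : I -> K) (S T : I -> 'I_n),
    (forall p, c p <> 0 -> same_end (S p) (T p)) ->
    \sum_(p <- s) scal (c p) * hom (S p) (T p) +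
    \sum_(p <- s) scal (e p) * shift (S p) = 0 ->
    (forall i j : 'I_n, same_end i j ->
       \sum_(p <- s | (S p == i) && (T p == j)) c p = 0) /\
    (forall l : 'I_n, ((r l).+1 < n)%N -> \sum_(p <- s | S p == l) e p = 0)
}.

Section ExtComputation.
Variables (K : fieldType) (A : pzAlgType K) (n : nat) (q : tri_basis A n).
Variables (M : fdMod A) (P : resolution M) (r : nat -> nat) (g : M).
Local Notation co := (coef q).
Local Notation d := (res_d P).
Local Notation aug := (res_aug P).

Hypothesis r_bound : forall i, (i < n)%N -> (i <= r i < n)%N.
Hypothesis r_nested : forall i j, (i < n)%N -> (i <= j <= r i)%N -> (r j <= r i)%N.
Hypothesis g_gen : surj (orbit_map g).
Hypothesis g_ann : forall a, a *: g = 0 <->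
  forall i k : nat, (i < n)%N -> (k <= r i)%N -> co a i k = 0.

(* b is stable if a *: g |-> (a * b) *: g is a well-defined endomorphism of M. *)
Definition stable (b : A) : Prop := forall a, a *: g = 0 -> (a * b) *: g = 0.

Definition same_end (i j : nat) : bool := (j <= i < n)%N && (r i == r j).

Lemma stable_elt i j : same_end i j -> stable (q j i).
Proof.
move=> /andP [/andP [ji i_n] /eqP rij] a /g_ann H; apply/g_ann => s t sn tr.
rewrite coef_mul_elt; case: eqP => [sj|] //=.
by case: ifP => // _; apply: H => //; rewrite rij -sj.
Qed.

(* For a annihilating g, quot l a is the element c supported at r l + 1 such
   that c * q l (r l + 1) = a * q l l. *)
Definition quot (l : nat) (a : A) : A :=
  \sum_(t < n) scal (co a l t) * q (r l).+1 t.

Lemma coef_quot l a j t :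
  co (quot l a) j t = if (j == (r l).+1) && (j <= t)%N then co a l t else 0.
Proof.
rewrite coef_sum; have [tn|tn] := ltnP t n; last first.
  rewrite (@coef_out _ _ _ q a) ?if_same; last by rewrite andbC ltnNge tn.
  rewrite big1 // => u _; rewrite coefZ coef_elt.
  have /eqP/negPf -> : u <> t :> nat by move=> e; have := ltn_ord u; lia.
  by rewrite andbF mulr0.
rewrite (bigD1 (Ordinal tn)) //= big1 ?addr0 => [|u nu]; rewrite coefZ coef_elt.
  rewrite eqxx tn andbT eq_sym; case: eqP => [->|_] /=; last by rewrite mulr0.
  by case: leqP; rewrite ?mulr1 ?mulr0.
by rewrite (negPf (nu : u != t :> nat)) andbF mulr0.
Qed.

Lemma quot_add l a b : quot l (a + b) = quot l a + quot l b.
Proof.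
rewrite /quot -big_split /=; apply: eq_bigr => t _.
by rewrite coefD rmorphD mulrDl.
Qed.

(** On the annihilator of g, paths from l occur only if they end beyond r l; there division by
    [q l (r l).+1] commutes with left multiplication. *)
Lemma quot_mul l a b : (l < n)%N -> a *: g = 0 -> quot l (b * a) = b * quot l a.
Proof.
move=> ln /g_ann aK; apply: (@coef_inj _ _ _ q) => s t /andP [st tn].
rewrite coef_quot !coefM; case: eqP => [sl|ne] /=; last first.
  by rewrite big1 // => u _; rewrite coef_quot; case: eqP => // _; rewrite mul0r.
rewrite st; apply: eq_bigr => u _; rewrite coef_quot {1}sl eqxx /=.
by case: leqP => // us; rewrite aK // -ltnS -sl.
Qed.

Lemma quot_elt l a : (l < n)%N -> a *: g = 0 ->
  quot l a * q l (r l).+1 = a * q l l.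
Proof.
move=> ln /g_ann aK; apply: (@coef_inj _ _ _ q) => s t /andP [st tn].
rewrite !coef_mul_elt leqnn ln andbT; case: eqP => //= sl.
have /andP [lr _] := r_bound ln; have tr := aK l t ln.
rewrite (leqW lr) /= coef_quot eqxx /=.
have [tl|tl] := leqP t (r l); last by case: ltnP => //; lia.
by rewrite tr //; do 2?case: ifP.
Qed.

Lemma quot_right l a : quot l a * q (r l).+1 (r l).+1 = quot l a.
Proof.
apply: (@coef_inj _ _ _ q) => s t /andP [st tn].
rewrite coef_mul_elt !coef_quot leqnn /= !eqxx /=.
case: eqP => //= sl; have -> : ((r l).+1 < n)%N by lia.
by rewrite sl.
Qed.

Lemma quot_below l a j : (j <= l < n)%N -> a *: g = 0 ->
  quot l a * q j (r l).+1 = a * q j l.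
Proof.
move=> /andP [jl ln] aK; have /andP [lr _] := r_bound ln.
have -> : q j (r l).+1 = q l (r l).+1 * q j l by rewrite eltM ?eqxx // leqW.
by rewrite mulrA quot_elt // -mulrA eltM // eqxx.
Qed.

Lemma quot_same_end i j a : same_end i j -> quot j (a * q j i) = quot i a.
Proof.
move=> /andP [/andP [ji i_n] /eqP rij]; rewrite /quot -rij.
by apply: eq_bigr => t _; rewrite coef_mul_elt eqxx ji i_n.
Qed.

(** Comparison data between P and 0 -> sum of the P(r l + 1) -> A -> M -> 0: [pi] goes from P to A
    over M, while [y] and [z] are the images in P of the generators. *)
Variables (pi : P 0 -> A) (y : P 0) (z : nat -> P 1).
Hypothesis pi_lin : forall a u v, pi (a *: u + v) = a * pi u + pi v.
Hypothesis pi_aug : forall w, pi w *: g = aug w.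
Hypothesis aug_y : aug y = g.
Hypothesis d_z : forall l, (l < n)%N -> d 0 (z l) = q l (r l).+1 *: y.

Lemma pi_d w : pi (d 0 w) *: g = 0. Proof. by rewrite pi_aug aug_d. Qed.
Lemma pi0 : pi 0 = 0.
Proof.
by have := pi_lin 1 0 0; rewrite scale1r addr0 mul1r => /(congr1 (fun a => a - pi 0));
  rewrite subrr addrK.
Qed.
Lemma piZ a u : pi (a *: u) = a * pi u.
Proof. by rewrite -[a *: u]addr0 pi_lin pi0 addr0. Qed.

Lemma hom_linear b : linear (fun w => (pi w * b) *: g).
Proof. by move=> a u v; rewrite pi_lin mulrDl scalerDl -mulrA -scalerA. Qed.
Definition hom_coc b : {linear P 0 -> M} := mklin (hom_linear b).

Lemma ext_linear (l : 'I_n) b : linear (fun w => (quot l (pi (d 0 w)) * b) *: g).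
Proof.
move=> a u v; rewrite linearP pi_lin quot_add quot_mul ?pi_d //.
by rewrite mulrDl scalerDl -mulrA -scalerA.
Qed.
(** [quot l] projects the annihilator of g onto its summand P(r l + 1); after [pi] and d it is a
    component of the comparison map in degree 1, and b tells where the generator of that summand
    goes. *)
Definition ext_coc (l : 'I_n) b : {linear P 1 -> M} := mklin (ext_linear l b).

Lemma hom_closed b : stable b -> closed (hom_coc b).
Proof. by move=> bs v; apply/bs/pi_d. Qed.

Lemma quot0 l : quot l 0 = 0.
Proof. by rewrite /quot big1 // => t _; rewrite coef0 rmorph0 mul0r. Qed.

Lemma ext_closed l b : closed (ext_coc l b).
Proof. by move=> v /=; rewrite d_d pi0 quot0 mul0r scale0r. Qed.

(** If F lifts the right factor, pi (F 0 v) and pi v * b' act equally on g, and stability of b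
    preserves this under right multiplication by b, so both sides agree as cochains. The order flips
    because endomorphisms of A g are right multiplications. *)
Lemma hom_mul b b' : stable b -> stable b' ->
  ext_of (hom_coc b) * ext_of (hom_coc b') = ext_of (hom_coc (b' * b)).
Proof.
move=> bs bs'.
have [F [F1 _ [_ ->]]] := ext_of_mul (hom_closed bs) (hom_closed bs').
apply: eq_ext_of => v /=; apply/eqP; rewrite -subr_eq0 -scalerBl mulrA -mulrBl.
by apply/eqP/bs; rewrite scalerBl pi_aug F1 subrr.
Qed.

Lemma hom_ext b l c : stable b ->
  ext_of (hom_coc b) * ext_of (ext_coc l c) = ext_of (ext_coc l (c * b)).
Proof.
move=> bs; have [F [F1 _ [_ ->]]] := ext_of_mul (hom_closed bs) (@ext_closed l c).
apply: eq_ext_of => v /=; apply/eqP; rewrite -subr_eq0 -scalerBl mulrA -mulrBl.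
by apply/eqP/bs; rewrite scalerBl pi_aug F1 subrr.
Qed.

(** By [quot_below] this map on P(r l + 1) extends to P(l), hence it is the coboundary of
    [hom_coc (q j l)]. *)
Lemma ext_coc_below (l : 'I_n) j : (j <= l)%N -> ext_of (ext_coc l (q j (r l).+1)) = 0.
Proof.
move=> jl; rewrite -(@ext_of_zero _ _ _ P 1 \0) //.
apply: (ext_of_exact (h := hom_coc (q j l))) => //; first exact: ext_closed.
by move=> v; rewrite subr0 /= quot_below ?jl ?ltn_ord ?pi_d.
Qed.

(** The lift is needed in degree 1, where d F_1 = F_0 d reduces it to F_0. Replacing pi (F 0 w) by
    pi w * q j i changes it by an element delta w annihilating g, which contributes exactly the
    coboundary of w |-> quot j (delta w) *: g. *)
Lemma ext_hom (i j : 'I_n) : same_end i j ->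
  ext_of (ext_coc j 1) * ext_of (hom_coc (q j i)) = ext_of (ext_coc i 1).
Proof.
move=> ij; have bs := stable_elt ij.
have [F [F1 F2 [FC ->]]] := ext_of_mul (@ext_closed j 1) (hom_closed bs).
pose delta w := pi (F 0 w) - pi w * q j i.
have delta0 w : delta w *: g = 0 by rewrite scalerBl pi_aug F1 subrr.
have deltaP a u v : delta (a *: u + v) = a * delta u + delta v.
  rewrite /delta linearP !pi_lin mulrDl mulrBr opprD addrACA; congr (_ - _ + _).
  by rewrite mulrA.
have L : linear (fun w => quot j (delta w) *: g).
  by move=> a u v; rewrite deltaP quot_add quot_mul // scalerDl scalerA.
apply: (ext_of_exact (h := mklin L)) => //; first exact: ext_closed.
move=> v; rewrite /= F2 -scalerBl -(quot_same_end _ ij) !mulr1; congr (_ *: g).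
apply: (addIr (quot j (pi (d 0 v) * q j i))); rewrite -quot_add.
by rewrite !subrK.
Qed.

Lemma im_d0 w : aug w = 0 -> exists u, d 0 u = w.
Proof. by move/res_exact0. Qed.

Lemma quot_sum a : a *: g = 0 -> \sum_(l < n) quot l a * q l (r l).+1 = a.
Proof.
move=> aK; rewrite -[RHS]mulr1 -(elt_sum1 q) mulr_sumr.
by apply: eq_bigr => l _; rewrite quot_elt.
Qed.

(* The remainder of the identity of P 1 modulo the comparison with the
   resolution 0 -> sum of the P(r l + 1) -> sum of the P(l) -> M -> 0. *)
Lemma comparison_homotopy : exists (s : {linear P 0 -> P 1}) (t : {linear P 1 -> P 1}),
  (forall w, w = t w + s (d 0 w) + \sum_(l < n) quot l (pi (d 0 w)) *: z l) /\
  (forall w, d 0 (t w) = 0).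
Proof.
have L0 : linear (fun w => pi w *: y).
  by move=> a u v; rewrite pi_lin scalerDl scalerA.
have [s sP] : exists s : {linear P 0 -> P 1}, forall w, d 0 (s w) = w - pi w *: y.
  apply: (@proj_lift _ _ (P 0) (P 1) (P 0) (d 0)
    (idfun \- mklin L0 : {linear P 0 -> P 0})) => [|w]; first exact: res_proj.
  by apply: im_d0; rewrite /= linearB linearZ /= aug_y pi_aug subrr.
have L1 : linear (fun w => \sum_(l < n) quot l (pi (d 0 w)) *: z l).
  move=> a u v; rewrite scaler_sumr -big_split; apply: eq_bigr => l _.
  by rewrite linearP pi_lin quot_add quot_mul ?pi_d // scalerDl scalerA.
exists s, (idfun \- (s \o d 0) \- mklin L1 : {linear P 1 -> P 1}).
split=> w /=; first by rewrite addrAC subrK subrK.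
rewrite !linearB sP /= linear_sum.
under eq_bigr => l _ do rewrite linearZ /= d_z ?ltn_ord // scalerA.
by rewrite -scaler_suml quot_sum ?pi_d // subKr subrr.
Qed.

(** A map s with d s d = d splits the resolution there, so a closed f equals f s d. The first s
    comes from the homotopy, of which only the term t survives on boundaries; the next ones are
    obtained by lifting w - s (d w). *)
Lemma ext_vanish k (f : {linear P k.+2 -> M}) : ext_of f = 0.
Proof.
have [fc|nfc] := pselect (closed f); last by rewrite /ext_of; case: pselect.
have [s sP] : exists s : {linear P k.+1 -> P k.+2},
    forall w, d k.+1 (s (d k.+1 w)) = d k.+1 w.
  clear f fc; elim: k => [|k [s sP]].
    have [s [t [tE dt]]] := comparison_homotopy.
    have [h hP] : exists h : {linear P 1 -> P 2}, forall w, d 1 (h w) = t w.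
      by apply: proj_lift => [|w]; [exact: res_proj | apply/res_exact].
    exists h => w; rewrite hP [RHS]tE d_d linear0 pi0 addr0 big1 ?addr0 // => l _.
    by rewrite quot0 scale0r.
  have [h hP] : exists h : {linear P k.+2 -> P k.+3},
      forall w, d k.+2 (h w) = w - s (d k.+1 w).
    apply: (@proj_lift _ _ (P k.+2) (P k.+3) (P k.+2) (d k.+2)
      (idfun \- (s \o d k.+1) : {linear P k.+2 -> P k.+2})) => [|w].
      exact: res_proj.
    by apply/res_exact; rewrite /= linearB sP subrr.
  by exists h => w; rewrite hP /= d_d linear0 subr0.
rewrite -(@ext_of_zero _ _ _ P k.+2 \0) //.
apply: (ext_of_exact (h := f \o s)) => // v; rewrite subr0 /=; apply/eqP.
rewrite -subr_eq0 -linearB; apply/eqP.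
have [u <-] : exists u, d k.+2 u = v - s (d k.+1 v).
  by apply/res_exact; rewrite linearB sP subrr.
exact: fc.
Qed.

(** A closed f factors through M and is determined by f y = b *: g; the point is that, modulo the
    annihilator of g, b only involves pairs with equal right ends. *)
Lemma hom_span (f : {linear P 0 -> M}) : closed f ->
  exists c : 'I_n * 'I_n -> K, (forall p, c p <> 0 -> same_end p.1 p.2) /\
    ext_of f = \sum_p scal (c p) * ext_of (hom_coc (q p.2 p.1)).
Proof.
move=> fc; have f0 w : aug w = 0 -> f w = 0.
  by move/im_d0 => [u <-]; apply: fc.
have [b bE] := g_gen (f y).
pose c (p : 'I_n * 'I_n) := if same_end p.1 p.2 then co b p.2 p.1 else 0.
have cP p : c p <> 0 -> same_end p.1 p.2 by rewrite /c; case: ifP.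
exists c; split=> //; apply: ext_of_sum => [p /cP ps|w].
  exact/hom_closed/stable_elt.
have -> : f w = pi w *: f y.
  apply/eqP; rewrite -subr_eq0 -linearZ -linearB; apply/eqP/f0.
  by rewrite linearB linearZ /= aug_y pi_aug subrr.
have E : (b - \sum_p scal (c p) * q p.2 p.1) *: g = 0.
  apply/g_ann => j i jn ir; rewrite coefB coef_sum.
  have [ji|ij] := leqP j i; last first.
    rewrite coef_out ?big1 ?subrr // => [p _|]; last by rewrite leqNgt ij.
    by rewrite coefZ [X in _ * X]coef_out ?mulr0 // leqNgt ij.
  have i_n : (i < n)%N by have := r_bound jn; lia.
  pose p0 := (Ordinal i_n, Ordinal jn).
  rewrite (bigD1 p0) //= big1 ?addr0 => [|p np]; last first.
    rewrite coefZ coef_elt; case: eqP => [p2|_]; rewrite ?mulr0 //=.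
    case: eqP => [p1|_]; rewrite ?mulr0 //; case/eqP: np.
    by apply/eqP; rewrite [p]surjective_pairing xpair_eqE -!val_eqE /= p1 p2 !eqxx.
  rewrite coefZ coef_elt !eqxx ji i_n mulr1 /c /=.
  case: ifPn => [_|]; first by rewrite subrr.
  rewrite /same_end ji i_n /= => rij; rewrite subr0.
  have rlt : (r i < r j)%N.
    by rewrite ltn_neqAle rij; apply: r_nested => //; rewrite ji.
  (* This path kills g, hence also f y = b *: g. Multiplying b by it moves the coefficient at (j, i)
     to (j, r i + 1), which still acts on g because r i < r j. *)
  have aK : q i (r i).+1 *: g = 0.
    apply/g_ann => s t sn tr; rewrite coef_elt.
    by case: eqP => //= is_; case: eqP => //= rt; rewrite -is_ -rt ltnn in tr.
  have : (q i (r i).+1 * b) *: g = 0.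
    by rewrite -scalerA [b *: g]bE -linearZ f0 // linearZ /= aug_y.
  move/g_ann/(_ j (r i).+1 jn rlt); rewrite coef_elt_mul eqxx /=.
  by case: ifP => //; have := r_bound i_n; have := r_bound jn; lia.
have /eqP := E; rewrite scalerBl subr_eq0 => /eqP bS.
rewrite -bE /= bS scaler_suml scaler_sumr; apply: eq_bigr => p _.
by rewrite !scalerA mulrA -scalC -mulrA.
Qed.

(** Modulo coboundaries a |-> (a * e) *: g, the map given by b is a multiple of the one given by 1.
    Only the paths in b from some j to s = r l + 1 matter: for j <= l they go into e by
    [quot_below], j = s gives the scalar, and for l < j < s nesting yields r j < s, so they kill
    g. *)
Lemma quot_span (l : 'I_n) b : exists e, forall a, a *: g = 0 ->
  (quot l a * b) *: g =
  (scal (co b (r l).+1 (r l).+1) * quot l a) *: g + (a * e) *: g.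
Proof.
set s := (r l).+1; have /andP [lr rn] := r_bound (ltn_ord l).
exists (\sum_(j < n) if (j <= l)%N then scal (co b j s) * q j l else 0) => a aK.
have bE : q s s * b = \sum_(j < n) scal (co b j s) * q j s.
  apply: (@coef_inj _ _ _ q) => u t /andP [ut tn].
  have un := leq_ltn_trans ut tn; rewrite coef_elt_mul leqnn coef_sum.
  rewrite (bigD1 (Ordinal un)) //= big1 ?addr0 => [|j ju]; rewrite coefZ coef_elt.
    rewrite eqxx [s == t]eq_sym /=; case: eqP => [st|_] /=; last by rewrite mulr0.
    by rewrite -st tn ut mulr1.
  by rewrite (negPf (ju : j != u :> nat)) mulr0.
have -> : quot l a * b = \sum_(j < n) scal (co b j s) * (quot l a * q j s).
  rewrite -[in LHS]quot_right -mulrA bE mulr_sumr; apply: eq_bigr => j _.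
  by rewrite mulrA -scalC -mulrA.
have -> : (scal (co b s s) * quot l a) *: g =
    \sum_(j < n) if (j == s :> nat) then (scal (co b j s) * quot l a) *: g else 0.
  have [sn|sn] := ltnP s n.
    rewrite (bigD1 (Ordinal sn)) //= eqxx big1 ?addr0 // => j js.
    by rewrite (negPf (js : j != s :> nat)).
  rewrite coef_out ?rmorph0 ?mul0r ?scale0r; last by rewrite andbC ltnNge sn.
  by rewrite big1 // => j _; case: eqP => // e; have := ltn_ord j; rewrite e ltnNge sn.
rewrite mulr_sumr !scaler_suml -big_split /=; apply: eq_bigr => j _.
case: eqP => [->|js].
  by rewrite quot_right ifN ?mulr0 ?scale0r ?addr0 // -ltnNge ltnS.
rewrite add0r; case: leqP => [jl|lj].
  by rewrite quot_below ?jl ?ltn_ord // [in RHS]mulrA -scalC -mulrA.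
rewrite mulr0 scale0r -scalerA -scalerA.
have -> : q j s *: g = 0; last by rewrite !scaler0.
apply/g_ann => u t un tr; rewrite coef_elt; case: eqP => // ju; case: eqP => // st.
have [js'|sj] := leqP j s; last by [].
have := @r_nested l j (ltn_ord l); rewrite -ju -st in tr.
by move/(_ (ltac:(lia))); lia.
Qed.

(** By the homotopy, f is determined modulo coboundaries by the values f (z l), since it kills the
    boundary t w; [quot_span] then reduces each value to a scalar. *)
Lemma ext_span (f : {linear P 1 -> M}) : closed f ->
  exists c : 'I_n -> K, (forall l, c l <> 0 -> ((r l).+1 < n)%N) /\
    ext_of f = \sum_l scal (c l) * ext_of (ext_coc l 1).
Proof.
move=> fc; have [s [t [tE dt]]] := comparison_homotopy.
pose b (l : 'I_n) : A := projT1 (cid (g_gen (f (z l)))).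
have bE l : b l *: g = f (z l) by exact: projT2 (cid (g_gen (f (z l)))).
pose e l := projT1 (cid (quot_span l (b l))).
pose c (l : 'I_n) := co (b l) (r l).+1 (r l).+1.
have eE (l : 'I_n) a : a *: g = 0 ->
    (quot l a * b l) *: g = (scal (c l) * quot l a) *: g + (a * e l) *: g.
  exact: (projT2 (cid (quot_span l (b l))) a).
exists c; split=> [l cl|].
  by rewrite ltnNge; apply/negP => sn; apply: cl; rewrite /c coef_out // andbC ltnNge sn.
have L : linear (fun w => \sum_l (scal (c l) : A) *: ext_coc l 1 w).
  move=> a u v; rewrite scaler_sumr -big_split /=; apply: eq_bigr => l _.
  rewrite (ext_linear l 1); exact: scal_linear.
have Lc : closed (mklin L : {linear P 1 -> M}).
  by move=> v /=; rewrite big1 // => l _; rewrite [X in _ *: X]ext_closed scaler0.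
rewrite -(ext_of_sum (f := mklin L)) // => [|l _]; last exact: ext_closed.
apply: (ext_of_exact (h := f \o s \+ hom_coc (\sum_l e l))) => // w.
have [u uE] : exists u, d 1 u = t w by apply/res_exact.
rewrite {1}(tE w) !linearD -uE fc add0r linear_sum /= -addrA; congr (_ + _).
rewrite mulr_sumr scaler_suml -sumrB; apply: eq_bigr => l _.
by rewrite linearZ /= -bE !scalerA mulr1 eE ?pi_d // addrAC subrr add0r.
Qed.

(** Degree 0 is tested at y, degree 1 at the z l. The labels S, T on an arbitrary list permit the
    use on the support of an element of KQ, labelled by sources and targets. *)
Lemma ext_independent (I : Type) (s : seq I) (c e : I -> K) (S T : I -> 'I_n) :
  (forall p, c p <> 0 -> same_end (S p) (T p)) ->
  \sum_(p <- s) scal (c p) * ext_of (hom_coc (q (T p) (S p))) +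
  \sum_(p <- s) scal (e p) * ext_of (ext_coc (S p) 1) = 0 ->
  (forall i j : 'I_n, same_end i j ->
     \sum_(p <- s | (S p == i) && (T p == j)) c p = 0) /\
  (forall l : 'I_n, ((r l).+1 < n)%N -> \sum_(p <- s | S p == l) e p = 0).
Proof.
move=> cP.
have L0 : linear (fun w => \sum_(p <- s) (scal (c p) : A) *: hom_coc (q (T p) (S p)) w).
  move=> a u v; rewrite scaler_sumr -big_split /=; apply: eq_bigr => p _.
  rewrite (hom_linear (q (T p) (S p))); exact: scal_linear.
have L1 : linear (fun w => \sum_(p <- s) (scal (e p) : A) *: ext_coc (S p) 1 w).
  move=> a u v; rewrite scaler_sumr -big_split /=; apply: eq_bigr => p _.
  rewrite (ext_linear (S p) 1); exact: scal_linear.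
have hc p : c p <> 0 -> closed (hom_coc (q (T p) (S p))).
  by move=> /cP ?; apply/hom_closed/stable_elt.
rewrite -(ext_of_sum (f := mklin L0)) // -(ext_of_sum (f := mklin L1)) //; last first.
  by move=> p _; apply: ext_closed.
have c0 : closed (mklin L0 : {linear P 0 -> M}).
  move=> v /=; rewrite big1 // => p _; have [->|/eqP /hc h] := eqVneq (c p) 0.
    by rewrite rmorph0 scale0r.
  by rewrite [X in _ *: X]h scaler0.
have c1 : closed (mklin L1 : {linear P 1 -> M}).
  by move=> v /=; rewrite big1 // => p _; rewrite [X in _ *: X]ext_closed scaler0.
move=> /(ext_of_add_eq0 c0 c1) [/(_ y) /= H0 [u H1]].
have y1 a : ((pi y - 1) * a) *: g = 0 -> (pi y * a) *: g = a *: g.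
  by rewrite mulrBl scalerBl mul1r => /eqP; rewrite subr_eq0 => /eqP.
have y0 : (pi y - 1) *: g = 0 by rewrite scalerBl scale1r pi_aug aug_y subrr.
split=> [i j ij|l ln].
  have E : (\sum_(p <- s) scal (c p) * q (T p) (S p)) *: g = 0.
    rewrite scaler_suml -[RHS]H0; apply: eq_bigr => p _.
    have [->|/eqP /cP cp] := eqVneq (c p) 0; first by rewrite rmorph0 mul0r !scale0r.
    by rewrite -scalerA y1 //; apply: (stable_elt cp).
  have [/andP [ji i_n] /eqP rij] := andP ij.
  have := r_bound i_n; rewrite rij => /andP [ir _].
  have /g_ann /(_ j i (leq_ltn_trans ji i_n) ir) := E.
  rewrite coef_sum => H; rewrite -[RHS]H [LHS]big_mkcond; apply: eq_bigr => p _.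
  rewrite coefZ coef_elt -!val_eqE andbC; case: eqP => [->|_] /=; last by rewrite mulr0.
  by case: eqP => [->|_]; rewrite ?mulr0 // ji i_n mulr1.
have [b bE] := g_gen (u y).
have E : (\sum_(p <- s) scal (e p) * quot (S p) (q l (r l).+1 * pi y) -
    q l (r l).+1 * b) *: g = 0.
  rewrite scalerBl -[X in _ - X]scalerA [b *: g]bE -linearZ -d_z //= -H1 /=.
  rewrite scaler_suml -sumrB big1 // => p _.
  by rewrite d_z // piZ mulr1 scalerA subrr.
have := r_bound ln; set m := (r l).+1 in ln E *; move=> /andP [mr _].
have lm : (l < m)%N by have := r_bound (ltn_ord l); rewrite /m; lia.
(* At (m, m) the term q l m * b has no coefficient, since b contains no path from m down to l; among
   the quotients only those with S p = l contribute, because pi y - 1 annihilates g. *)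
have /g_ann /(_ m m ln mr) := E.
rewrite coefB coef_elt_mul (@coef_out _ _ _ q b) ?if_same ?subr0; last first.
  by rewrite negb_and -ltnNge lm.
rewrite coef_sum => H; rewrite -[RHS]H [LHS]big_mkcond; apply: eq_bigr => p _.
rewrite coefZ coef_quot leqnn andbT coef_elt_mul eqxx (ltnW lm) ln /=.
have -> : co (pi y) (S p) l = co (pi y - 1) (S p) l + (S p == l)%:R.
  by rewrite coefB coef1 ltn_ord andbT subrK.
case: (eqVneq (S p) l) => [->|pl].
  by rewrite eqxx (iffLR (g_ann _) y0) ?ltn_ord ?add0r ?mulr1 //; lia.
case: eqP => [mp|_]; last by rewrite mulr0.
rewrite (iffLR (g_ann _) y0) ?ltn_ord ?addr0 ?mulr0 //.
by have := r_bound (ltn_ord l); rewrite /m in mp; lia.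
Qed.

Lemma same_end_refl (i : 'I_n) : same_end i i.
Proof. by rewrite /same_end leqnn ltn_ord eqxx. Qed.

Lemma shift_one (l : 'I_n) :
  ext_of (ext_coc l 1) = ext_of (ext_coc l (q (r l).+1 (r l).+1)).
Proof. by apply: eq_ext_of => v /=; rewrite quot_right mulr1. Qed.

Lemma ext_coc_hom_sum1 : \sum_i ext_of (hom_coc (q (i : 'I_n) i)) = 1.
Proof.
rewrite -(ext_of1 P).
rewrite (ext_of_sum (s := index_enum _) (c := fun=> 1)
  (F := fun i : 'I_n => hom_coc (q i i))) => [|i _|v].
- by apply: eq_bigr => i _; rewrite rmorph1 mul1r.
- exact/hom_closed/stable_elt/same_end_refl.
- rewrite -pi_aug -[pi v in LHS]mulr1 -(elt_sum1 q) mulr_sumr scaler_suml.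
  by apply: eq_bigr => i _; rewrite rmorph1 scale1r.
Qed.

Lemma standard_ext : interval_ext n r same_end (ext_gr P).
Proof.
exists (fun i j => ext_of (hom_coc (q j i))) (fun l => ext_of (ext_coc l 1)).
- exact: ext_gr0.
- exact: ext_grD.
- exact: ext_grZ.
- exact: ext_gr_ind.
- by move=> i j; apply: ext_of_gr.
- by move=> l; apply: ext_of_gr.
- exact: ext_coc_hom_sum1.
- move=> i j ij; rewrite hom_mul; try exact/stable_elt/same_end_refl.
  apply: ext_of_zero => v /=.
  by rewrite eltM // ifN ?mulr0 ?scale0r //; apply: contra_notN ij => /eqP/val_inj.
- move=> i j k ij jk; rewrite hom_mul; try exact: stable_elt.
  congr (ext_of (hom_coc _)); rewrite eltM ?eqxx //.
    by case/andP: jk => /andP [].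
  by case/andP: ij => /andP [].
- exact: ext_hom.
- move=> l k j kl kj; rewrite shift_one hom_ext; last exact: stable_elt.
  have jk : (j <= k)%N by case/andP: kj => /andP [].
  rewrite -kl eltM // eqxx; case: eqVneq => [<-|nkj]; first by [].
  (* If l < j < k = r l + 1, nesting would give r j <= r l < k <= r k, against r k = r j. *)
  have lk : (j <= l)%N.
    have {jk nkj} jk : (j < k)%N by rewrite ltn_neqAle jk eq_sym andbT.
    rewrite leqNgt; apply/negP => lj; case/andP: kj => _ /eqP rkj.
    have := @r_nested l j (ltn_ord l); have := r_bound (ltn_ord k); lia.
  by rewrite kl ext_coc_below.
- move=> l m; have [F [_ _ [_ ->]]] := ext_of_mul (@ext_closed l 1) (@ext_closed m 1).
  exact: ext_vanish.
- by move=> u /ext_grP [f /hom_span [c [cP ->]] ->]; exists c.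
- by move=> u /ext_grP [f /ext_span [c [cP ->]] ->]; exists c.
- by move=> k u /ext_grP [f _ ->]; apply: ext_vanish.
- exact: ext_independent.
Qed.

End ExtComputation.

(** * In-order labels *)

Section InOrder.

(* The last label of the right subtree of the vertex labelled i, or i itself if
   that subtree is empty, in the tree T with labels m, m + 1, ... *)
Fixpoint rlast (m : nat) (T : bintree) (i : nat) : nat :=
  if T is Node l r then
    let x := (m + nvert l)%N in
    if (i < x)%N then rlast m l i else if i == x then (x + nvert r)%N
    else rlast x.+1 r i
  else i.

Lemma has_label_inorder m T i :
  has_label (inorder_from m T) i = (m <= i < m + nvert T)%N.
Proof.
elim: T m => [|l IHl r IHr] m /=; first by lia.
by rewrite IHl IHr; lia.
Qed.

Lemma root_label_inorder m T i :
  root_label (inorder_from m T) i -> (m <= i < m + nvert T)%N.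
Proof. by case: T => //= l r /eqP <-; lia. Qed.

Lemma rlast_bounds m T i :
  (m <= i < m + nvert T)%N -> (i <= rlast m T i < m + nvert T)%N.
Proof.
elim: T m => [|l IHl r IHr] m /=; first by lia.
move=> iT; case: ltngtP => [il|ir|->]; last by lia.
  by have := IHl m; lia.
by have := IHr (m + nvert l).+1; lia.
Qed.

Lemma rlast_nested m T i j :
  (m <= i < m + nvert T)%N -> (i <= j <= rlast m T i)%N ->
  (rlast m T j <= rlast m T i)%N.
Proof.
elim: T m => [|l IHl r IHr] m /=; first by lia.
move=> iT; case: (ltngtP i (m + nvert l)) => [il|ir|ix] ij.
- have := @rlast_bounds m l i; have := IHl m.
  by case: (ltngtP j (m + nvert l)); lia.
- have := IHr (m + nvert l).+1.
  by case: (ltngtP j (m + nvert l)); lia.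
- have := @rlast_bounds (m + nvert l).+1 r j.
  by case: (ltngtP j (m + nvert l)); lia.
Qed.

Lemma is_below_labels m T i j : is_below (inorder_from m T) i j ->
  (m <= i < m + nvert T)%N /\ (m <= j < m + nvert T)%N.
Proof.
elim: T m => [|l IHl r IHr] m //= /or3P [|/IHl|/IHr]; try by lia.
by rewrite !has_label_inorder => /andP [/eqP <-]; lia.
Qed.

Lemma is_below_gt m T i j : (m <= i < m + nvert T)%N -> (i < j)%N ->
  is_below (inorder_from m T) j i = (j <= rlast m T i)%N.
Proof.
elim: T m => [|l IHl r IHr] m /=; first by lia.
move=> iT ij; rewrite !has_label_inorder.
have bl := @is_below_labels m l j i.
have br := @is_below_labels (m + nvert l).+1 r j i.
case: (ltngtP i (m + nvert l)) => [il|ir|ix] /=.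
- rewrite (IHl m) //; last by lia.
  by case: is_below br => [/(_ isT)|_]; [lia | rewrite orbF].
- rewrite (IHr (m + nvert l).+1) //; last by lia.
  by case: is_below bl => [/(_ isT)|_ //]; lia.
- by case: is_below bl => [/(_ isT)|_]; case: is_below br => [/(_ isT)|_]; lia.
Qed.

Lemma is_lchild_labels m T i j : is_lchild (inorder_from m T) i j ->
  [/\ (m <= i < m + nvert T)%N, (m <= j < m + nvert T)%N
    & ~~ root_label (inorder_from m T) i].
Proof.
elim: T m => [|l IHl r IHr] m //= /or3P [|/IHl [] *|/IHr [] *]; try by split; lia.
by move=> /andP [/eqP <- /root_label_inorder *]; split; lia.
Qed.

Lemma is_rchild_labels m T i j : is_rchild (inorder_from m T) i j ->
  [/\ (m <= i < m + nvert T)%N, (m <= j < m + nvert T)%N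
    & ~~ root_label (inorder_from m T) i].
Proof.
elim: T m => [|l IHl r IHr] m //= /or3P [|/IHl [] *|/IHr [] *]; try by split; lia.
by move=> /andP [/eqP <- /root_label_inorder *]; split; lia.
Qed.

Lemma rlast_root m T i : root_label (inorder_from m T) i ->
  (rlast m T i).+1 = (m + nvert T)%N.
Proof. by case: T => //= l r /eqP <-; rewrite ltnn eqxx; lia. Qed.

Lemma rlast_before_root m T i j : root_label (inorder_from m T) i ->
  (m <= j < i)%N -> (rlast m T j < i)%N.
Proof.
case: T => //= l r /eqP <- jx; have := @rlast_bounds m l j.
by case: ltngtP jx; lia.
Qed.

(** A left child is the root of the left subtree of j, so its right end is the last label of that
    subtree, the one just before j. *)
Lemma is_lchildE m T i j :
  is_lchild (inorder_from m T) i j -> j = (rlast m T i).+1.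
Proof.
elim: T m => [|l IHl r IHr] m //= /or3P [/andP [/eqP <- rl]|h|h].
- have := root_label_inorder rl; have := rlast_root rl.
  by case: (ltngtP i (m + nvert l)); lia.
- have [? _ _] := is_lchild_labels h; have := IHl m h.
  by case: (ltngtP i (m + nvert l)); lia.
- have [? _ _] := is_lchild_labels h; have := IHr _ h.
  by case: (ltngtP i (m + nvert l)); lia.
Qed.

Lemma is_rchildE m T i j :
  is_rchild (inorder_from m T) i j -> (j < i)%N /\ rlast m T i = rlast m T j.
Proof.
elim: T m => [|l IHl r IHr] m //= /or3P [/andP [/eqP <- rl]|h|h].
- have := root_label_inorder rl; have := rlast_root rl; rewrite ltnn eqxx.
  by case: (ltngtP i (m + nvert l)); lia.
- have [? ? _] := is_rchild_labels h; have := IHl m h.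
  by case: (ltngtP i (m + nvert l)); case: (ltngtP j (m + nvert l)); lia.
- have [? ? _] := is_rchild_labels h; have := IHr _ h.
  by case: (ltngtP i (m + nvert l)); case: (ltngtP j (m + nvert l)); lia.
Qed.

Lemma is_rchild_inj m T i j j' : is_rchild (inorder_from m T) i j ->
  is_rchild (inorder_from m T) i j' -> j = j'.
Proof.
elim: T m => [|l IHl r IHr] m //=.
case/or3P => [/andP [/eqP <- rl]|h|h]; case/or3P => [/andP [/eqP <- rl']|h'|h'] //;
  try (by apply: IHl h h'); try (by apply: IHr h h');
  try (have A := root_label_inorder rl); try (have A := root_label_inorder rl');
  try (have B := is_rchild_labels h); try (have B' := is_rchild_labels h');
  try (by move: B A; rewrite rl'; case; lia);
  try (by move: B' A; rewrite rl; case; lia);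
  try (by case: B; lia); try (by case: B'; lia);
  by move: B B' => [? ? ?] []; lia.
Qed.

(** Labels strictly between a vertex and its right child fill the left subtree of that child, so
    their right ends stay before it. *)
Lemma is_rchild_between m T i j k : is_rchild (inorder_from m T) i j ->
  (j < k < i)%N -> (rlast m T k < i)%N.
Proof.
elim: T m => [|l IHl r IHr] m //= /or3P [/andP [/eqP <- rl]|h|h] jk.
- have := root_label_inorder rl; have := @rlast_before_root _ _ _ k rl.
  by case: (ltngtP k (m + nvert l)); lia.
- have [? ? _] := is_rchild_labels h; have := IHl m h jk.
  by case: (ltngtP k (m + nvert l)); lia.
- have [? ? _] := is_rchild_labels h; have := IHr _ h jk.
  by case: (ltngtP k (m + nvert l)); lia.
Qed.

Lemma is_child_disjoint m T i j j' : is_lchild (inorder_from m T) i j ->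
  ~~ is_rchild (inorder_from m T) i j'.
Proof.
elim: T m => [|l IHl r IHr] m //=.
case/or3P => [/andP [_ rl]|h|h]; apply/or3P => -[/andP [_ rl']|h'|h'];
  try (by apply: negP h'; apply: IHl h); try (by apply: negP h'; apply: IHr h);
  try (have A := root_label_inorder rl); try (have A' := root_label_inorder rl');
  try (have B := is_lchild_labels h); try (have B' := is_rchild_labels h');
  try (by move: B A'; rewrite rl'; case; lia);
  try (by move: B' A; rewrite rl; case; lia);
  try (by case: B; lia); try (by case: B'; lia);
  try (by lia); by move: B B' => [? ? ?] []; lia.
Qed.

(** The extra clause says that a left child is the least label with its right end: a chain of right
    children, read upwards, stops there. *)
Lemma parent_cases m T i : (m <= i < m + nvert T)%N ->
  ~~ root_label (inorder_from m T) i ->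
  (exists j, is_rchild (inorder_from m T) i j) \/
  is_lchild (inorder_from m T) i (rlast m T i).+1 /\
    forall j, (m <= j < i)%N -> rlast m T j <> rlast m T i.
Proof.
elim: T m => [|l IHl r IHr] m /=; first by lia.
move=> iT ix; case: (ltngtP i (m + nvert l)) ix => // [il|ir] _.
  have [rl|rl] := boolP (root_label (inorder_from m l) i).
    right; have := rlast_root rl => ->; rewrite eqxx; split=> // j ji.
    have := rlast_before_root rl ji; have := @rlast_bounds m l i.
    by case: (ltngtP j (m + nvert l)); lia.
  have [[j h]|[h H]] := IHl m (ltac:(lia)) rl.
    by left; exists j; rewrite h orbT.
  right; rewrite h orbT; split=> // j ji; have := H j.
  by case: (ltngtP j (m + nvert l)); lia.
have [rr|rr] := boolP (root_label (inorder_from (m + nvert l).+1 r) i).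
  by left; exists (m + nvert l)%N; rewrite eqxx.
have [[j h]|[h H]] := IHr (m + nvert l).+1 (ltac:(lia)) rr.
  by left; exists j; rewrite h !orbT.
right; rewrite h !orbT; split=> // j ji; have := H j.
have [_ + _] := is_lchild_labels h; have := @rlast_bounds m l j.
have := @rlast_bounds (m + nvert l).+1 r i.
by case: (ltngtP j (m + nvert l)); lia.
Qed.

End InOrder.

(** * Morphisms out of quotients of path algebras *)

Section PathAlgebraMorphism.
Variables (K : fieldType) (Q : quiver) (B : pzAlgType K) (w : qpath Q -> B).
Hypothesis w1 : \sum_v w (ptriv v) = 1.
Hypothesis wM : forall p p' r, pcomp p p' = Some r -> w r = w p * w p'.
Hypothesis w0 : forall p p', pcomp p p' = None -> w p * w p' = 0.

Definition path_ext (x : pathalg K Q) : B :=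
  \sum_(p <- msupp x) scal (mcoeff p x) * w p.

Lemma path_ext_supp (D : {fset qpath Q}%fset) x : (msupp x `<=` D)%fset ->
  path_ext x = \sum_(p <- D) scal (mcoeff p x) * w p.
Proof.
move=> sD; rewrite /path_ext; apply: big_fset_incl => // p _ /mcoeff_outdom ->.
by rewrite rmorph0 mul0r.
Qed.

Lemma path_ext_scal c x : path_ext (c *: x) = scal c * path_ext x.
Proof.
rewrite (path_ext_supp (msuppZ_le _ _)) mulr_sumr; apply: eq_bigr => p _.
by rewrite mcoeffZ rmorphM mulrA.
Qed.

Lemma path_extB : zmod_morphism path_ext.
Proof.
have D : {morph path_ext : x y / x + y}.
  move=> x y; rewrite (path_ext_supp (msuppD_le _ _)).
  rewrite (@path_ext_supp (msupp x `|` msupp y)%fset x) ?fsubsetUl //.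
  rewrite (@path_ext_supp (msupp x `|` msupp y)%fset y) ?fsubsetUr // -big_split /=.
  by apply: eq_bigr => p _; rewrite mcoeffD rmorphD mulrDl.
move=> x y; rewrite D -scaleN1r path_ext_scal rmorphN rmorph1 mulN1r.
by [].
Qed.
HB.instance Definition _ := GRing.isZmodMorphism.Build _ _ path_ext path_extB.

Lemma path_ext_elt p : path_ext (pelt K p) = w p.
Proof.
rewrite (@path_ext_supp [fset p]%fset) ?msuppU_le // big_seq_fset1 mcoeffUU.
by rewrite rmorph1 mul1r.
Qed.

Lemma path_extM : monoid_morphism path_ext.
Proof.
split=> [|x y].
  have -> : (1 : pathalg K Q) = pone K Q by [].
  rewrite /pone raddf_sum -[RHS]w1; apply: eq_bigr => v _; exact: path_ext_elt.
have -> : x * y = pmul x y by [].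
rewrite /pmul raddf_sum /= mulr_suml; apply: eq_bigr => p _.
rewrite raddf_sum /= mulr_sumr; apply: eq_bigr => p' _.
rewrite path_ext_scal rmorphM -!mulrA; congr (_ * _).
rewrite [w p * _]mulrA -scalC -mulrA; congr (_ * _).
rewrite /pmul_basis; case E: (pcomp p p') => [r|].
  by rewrite path_ext_elt (wM E).
by rewrite raddf0 w0.
Qed.
HB.instance Definition _ := GRing.isMonoidMorphism.Build _ _ path_ext path_extM.

Definition path_morph : {rmorphism pathalg K Q -> B} := path_ext.

Lemma path_ext_alg c : path_ext (scal c) = scal c.
Proof.
rewrite /scal /= /pscal path_ext_scal -[RHS]mulr1; congr (_ * _).
exact: (rmorph1 path_ext).
Qed.

End PathAlgebraMorphism.

Section QuotientMorphism.
Variables (K : pzRingType) (A B : pzAlgType K) (G : A -> Prop).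
Variable f : {rmorphism A -> B}.
Hypothesis fG : forall x, G x -> f x = 0.

Lemma ideal_gen_ker x : x \in ideal_gen G -> f x = 0.
Proof.
move=> /asboolP /(_ (fun x => f x = 0)); apply => //.
split=> [|a b fa fb|a b c fb]; first exact: rmorph0.
  by rewrite rmorphB fa fb subrr.
by rewrite !rmorphM fb mulr0 mul0r.
Qed.

Definition quot_map (u : quotalg G) : B := f (repr u).

Lemma quot_mapE x : quot_map (qproj G x) = f x.
Proof.
by apply/eqP; rewrite -subr_eq0 -rmorphB; apply/eqP/ideal_gen_ker/repr_qproj.
Qed.

Lemma quot_mapB : zmod_morphism quot_map.
Proof.
move=> u v; have [x ->] := qproj_surj u; have [y ->] := qproj_surj v.
have -> : qproj G x - qproj G y = qproj G (x - y).
  by apply: (addIr (qproj G y)); rewrite -qprojD !subrK.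
by rewrite !quot_mapE rmorphB.
Qed.
HB.instance Definition _ := GRing.isZmodMorphism.Build _ _ quot_map quot_mapB.

Lemma quot_mapM : monoid_morphism quot_map.
Proof.
split=> [|u v]; first by rewrite -[RHS](rmorph1 f) -quot_mapE.
have [x ->] := qproj_surj u; have [y ->] := qproj_surj v.
by rewrite [_ * _]qmulE !quot_mapE rmorphM.
Qed.
HB.instance Definition _ := GRing.isMonoidMorphism.Build _ _ quot_map quot_mapM.

Definition quot_morph : {rmorphism quotalg G -> B} := quot_map.

End QuotientMorphism.

(** * Paths in the tree quiver *)

Section TreeQuiverPaths.
Variables (n : nat) (T : bintree).
Hypothesis nT : nvert T = n.
Local Notation Q := (tree_quiver n T).
Local Notation r := (rlast 0 T).
Local Notation arrows := (seq (qarr Q)).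

Lemma tree_label (i : 'I_n) : (0 <= i < 0 + nvert T)%N.
Proof. by rewrite nT /=. Qed.

Lemma eps_tgt (e : eps_arrow n T) : (val e).2 = (r (val e).1).+1 :> nat.
Proof. exact: is_lchildE (valP e). Qed.

Lemma f_tgt (f : f_arrow n T) :
  ((val f).2 < (val f).1)%N /\ r (val f).1 = r (val f).2.
Proof. exact: is_rchildE (valP f). Qed.

(** All arrows point from child to parent, and a vertex is a child in at most one way. *)
Lemma arrow_src_inj (a b : qarr Q) : qsrc a = qsrc b -> a = b.
Proof.
case: a b => [[[i j] h]|[[i j] h]] [[[i' j'] h']|[[i' j'] h']] /= ii'; subst i'.
- have jj' : j = j' by apply: val_inj; rewrite /= (is_lchildE h) (is_lchildE h').
  by subst j'; congr inl; apply: val_inj.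
- by have := is_child_disjoint j' h; rewrite h'.
- by have := is_child_disjoint j h'; rewrite h.
- have jj' : j = j' by apply: val_inj; apply: is_rchild_inj h h'.
  by subst j'; congr inr; apply: val_inj.
Qed.

(* The degree of a word of arrows that avoids the relations, i.e., of the form
   f ... f or f ... f eps in the order of traversal; None for all other words. *)
Fixpoint word_deg (s : arrows) : option nat :=
  match s with
  | [::] => Some 0%N
  | inr _ :: s' => word_deg s'
  | inl _ :: s' => if s' is [::] then Some 1%N else None
  end.

Lemma word_deg_sum s k : word_deg s = Some k -> (\sum_(a <- s) tree_deg a)%N = k.
Proof.
elim: s => [|[e|f] s IH] /=; first by move=> [<-]; rewrite big_nil.
  by case: s IH => // _ [<-]; rewrite big_seq1.
by move=> /IH <-; rewrite big_cons.
Qed.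

Lemma word_deg_le1 s k : word_deg s = Some k -> (k <= 1)%N.
Proof. by elim: s => [|[e|f] [|a s] IH] //= [<-]. Qed.

Lemma word_deg_cat s t : word_deg (s ++ t) =
  match word_deg s with
  | Some 0 => word_deg t
  | Some _ => if t is [::] then word_deg s else None
  | None => None
  end.
Proof.
elim: s => [|[e|f] s IH] //=.
by case: s {IH} => [|a s] //=; case: t.
Qed.

Local Notation walk_end v s := (last v (map (@qtgt Q) s)).

Lemma walk_deg0 (v : 'I_n) s : @is_walk Q v s -> word_deg s = Some 0%N ->
  (walk_end v s <= v)%N /\ r v = r (walk_end v s).
Proof.
elim: s v => [|[e|f] s IH] v //=; first by case: s {IH}.
move=> /andP [/eqP <- /IH H] /H [le re]; have [lt rf] := f_tgt f.
by split; [exact: leq_trans le (ltnW lt) | exact: etrans rf re].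
Qed.

Lemma walk_deg0_lt (v : 'I_n) s : @is_walk Q v s -> word_deg s = Some 0%N ->
  s <> [::] -> (walk_end v s < v)%N.
Proof.
case: s => [|[e|f] s] //=; first by case: s.
move=> /andP [/eqP <- /walk_deg0 H] /H [le _] _.
by apply: leq_ltn_trans le _; have [] := f_tgt f.
Qed.

Lemma walk_deg0_nil (v : 'I_n) s : @is_walk Q v s -> word_deg s = Some 0%N ->
  walk_end v s = v -> s = [::].
Proof.
move=> ws ds e; have := walk_deg0_lt ws ds; rewrite e ltnn.
by case: s {ws ds e} => // a s; case.
Qed.

Lemma walk_deg1 (v : 'I_n) s : @is_walk Q v s -> word_deg s = Some 1%N ->
  walk_end v s = (r v).+1 :> nat.
Proof.
elim: s v => [|[e|f] s IH] v //=.
  by case: s {IH} => //= /andP [/eqP <- _] _; apply: eps_tgt.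
move=> /andP [/eqP <- /IH H] /H ->; have [_ rf] := f_tgt f.
by congr _.+1; exact: esym rf.
Qed.

(** There is only one way up from v, so one walk is a prefix of the other. Labels drop strictly
    along f arrows and an eps arrow ends an admissible word, which fixes the length. *)
Lemma walk_inj (v : 'I_n) s t k : @is_walk Q v s -> @is_walk Q v t ->
  word_deg s = Some k -> word_deg t = Some k -> walk_end v s = walk_end v t -> s = t.
Proof.
elim: s v t => [|a s IH] v [|b t] //.
- by move=> _ wt [<-] dt e; rewrite (walk_deg0_nil wt dt).
- by move=> ws _ ds [dt] e; rewrite (walk_deg0_nil ws) // dt.
move=> /= /andP [/eqP av ws] /andP [/eqP bv wt].
have ab : a = b := arrow_src_inj (etrans av (esym bv)).
rewrite -{}ab in wt *; case: a av ws wt => [e|f] av ws wt.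
  by case: s {IH ws} => // [[<-]]; case: t {wt}.
by move=> ds dt e; congr (_ :: _); apply: IH ws wt ds dt e.
Qed.

Lemma qpathE (p : qpath Q) : val p = (psrc p, parrows p).
Proof. by rewrite /psrc /parrows; case: (val p). Qed.

Lemma good_path_inj (p p' : qpath Q) k : psrc p = psrc p' -> ptgt p = ptgt p' ->
  word_deg (parrows p) = Some k -> word_deg (parrows p') = Some k -> p = p'.
Proof.
move=> s t dp dp'; apply: val_inj; rewrite !qpathE s; congr (_, _).
have := valP p; rewrite qpathE /= => wp; have := valP p'; rewrite qpathE /= => wp'.
by rewrite s in wp; move: t; rewrite /ptgt s; apply: walk_inj wp wp' dp dp'.
Qed.

Lemma tree_nonroot (i : 'I_n) j : (j < n)%N -> (r i).+1 = j \/ (j < i)%N /\ r i = r j ->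
  ~~ root_label (inorder_from 0 T) i.
Proof.
move=> jn H; apply/negP => ri; case: H => [rij|[ji rij]].
  by have := rlast_root ri; rewrite rij nT; lia.
have := rlast_before_root ri (_ : 0 <= j < i)%N; rewrite -rij => /(_ ji).
by have := rlast_bounds (tree_label i); lia.
Qed.

Lemma cons_path (a : qarr Q) (p : qpath Q) : qtgt a = psrc p ->
  exists2 p', psrc p' = qsrc a /\ ptgt p' = ptgt p & parrows p' = a :: parrows p.
Proof.
move=> ap; have [r rE] := @pcomp_ex Q p (parr a) ap.
by exists r; rewrite ?(pcomp_src rE) ?(pcomp_tgt rE) ?(pcomp_arrows rE).
Qed.

Lemma path_deg0 (i j : 'I_n) : (j <= i)%N -> r i = r j ->
  exists p : qpath Q, [/\ psrc p = i, ptgt p = j & word_deg (parrows p) = Some 0%N].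
Proof.
have [k] := ubnP (i : nat); elim: k i => // k IH i ik ji rij.
have [ij|ij] := eqVneq i j; first by subst j; exists (ptriv (i : qvert Q)).
have {ji ij} ji : (j < i)%N by rewrite ltn_neqAle ji eq_sym andbT.
have nr := @tree_nonroot i j (ltn_ord j) (or_intror (conj ji rij)).
have [[i' h]|[_ /(_ j ji) H]] := parent_cases (tree_label i) nr; last by case: H.
have [_ i'n _] := is_rchild_labels h; rewrite nT /= in i'n.
pose a : qarr Q := inr (exist (fun a : 'I_n * 'I_n => is_rchild (inorder T) a.1 a.2)
  (i, Ordinal i'n) h).
have [i'i ri'] := f_tgt (exist (fun a : 'I_n * 'I_n =>
  is_rchild (inorder T) a.1 a.2) (i, Ordinal i'n) h).
(* Otherwise j lies strictly between i' and its right child i, so r j < i, against r j = r i >=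
   i. *)
have ji' : (j <= i')%N.
  rewrite leqNgt; apply/negP => i'j; have := is_rchild_between h (_ : i' < j < i)%N.
  rewrite i'j ji -rij => /(_ isT).
  by have := rlast_bounds (tree_label i); lia.
have [||p [ps pt pd]] := IH (Ordinal i'n) _ ji'; first exact: leq_trans i'i _.
  by rewrite -rij.
have [p' [p's p't] p'E] := @cons_path a p (esym ps).
by exists p'; rewrite p's p't p'E.
Qed.

(** Steps from right children keep the right end, so the climb never reaches the root, whose right
    end is n - 1; it must meet a left child. *)
Lemma path_deg1 (i : 'I_n) : ((r i).+1 < n)%N ->
  exists p : qpath Q, psrc p = i /\ word_deg (parrows p) = Some 1%N.
Proof.
have [k] := ubnP (i : nat); elim: k i => // k IH i ik rin.
have nr := @tree_nonroot i (r i).+1 rin (or_introl erefl).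
have [[j h]|[h _]] := parent_cases (tree_label i) nr.
  have [_ jn _] := is_rchild_labels h; rewrite nT /= in jn.
  have [ji rij] := is_rchildE h.
  pose a : qarr Q := inr (exist (fun a : 'I_n * 'I_n => is_rchild (inorder T) a.1 a.2)
    (i, Ordinal jn) h).
  have [||p [ps pd]] := IH (Ordinal jn); first exact: leq_trans ji _.
    by rewrite /= -rij.
  have [p' [p's _] p'E] := @cons_path a p (esym ps).
  by exists p'; rewrite p's p'E.
pose a : qarr Q := inl (exist (fun a : 'I_n * 'I_n => is_lchild (inorder T) a.1 a.2)
  (i, Ordinal rin) h).
by exists (parr a).
Qed.

(** Such a word contains an eps arrow followed by another arrow, and these two form a generator of
    the ideal. *)
Lemma bad_path (K : fieldType) (p : qpath Q) : word_deg (parrows p) = None ->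
  pelt K p \in ideal_gen (tree_rel K n T).
Proof.
have bad s : word_deg s = None -> exists s1 e a s2, s = s1 ++ inl e :: a :: s2.
  elim: s => [|[e|f] s IH] //=; first by case: s {IH} => // a s _; exists [::], e, a, s.
  by move=> /IH [s1 [e [a [s2 ->]]]]; exists (inr f :: s1), e, a, s2.
move=> /bad [s1 [e [a [s2 pE]]]].
have := valP p; rewrite qpathE /= pE is_walk_cat /= => /and4P [w1 /eqP e1 /eqP ae w2].
pose p1 : qpath Q := exist (fun p => is_walk p.1 p.2) (psrc p, s1) w1.
pose p2 : qpath Q := exist (fun p => is_walk p.1 p.2) (@qtgt Q a, s2) w2.
have [c1 c1E] := @pcomp_ex Q (@parr Q a) (parr (inl e : qarr Q)) (esym ae).
have [c2 c2E] := @pcomp_ex Q c1 p1 (etrans (esym e1) (esym (pcomp_src c1E))).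
have [c3 c3E] := @pcomp_ex Q p2 c2 (etrans (pcomp_tgt c2E) (pcomp_tgt c1E)).
have peltM (x y z : qpath Q) : pcomp x y = Some z -> pelt K x * pelt K y = pelt K z.
  by move=> E; rewrite [LHS]pmul_pelt /pmul_basis E.
have regroup (R : pzRingType) (x y z t u v w : R) :
    x * y = u -> u * t = v -> z * v = w -> w = z * (x * y) * t.
  by move=> -> <- <-; rewrite mulrA.
have -> : p = c3.
  apply: val_inj; rewrite !qpathE (pcomp_src c3E) (pcomp_src c2E).
  rewrite (pcomp_arrows c3E) (pcomp_arrows c2E) (pcomp_arrows c1E) pE.
  by rewrite /parrows /= -!catA.
rewrite (regroup _ _ _ _ _ _ _ _ (peltM _ _ _ c1E) (peltM _ _ _ c2E) (peltM _ _ _ c3E)).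
case: (ideal_genP (tree_rel K n T)) => _ _; apply; apply/asboolP => J _; apply.
case: a ae {w2 p2 c1E c2E c3E c3 c2 c1 pE} => [e'|f] ae.
  by right; exists e, e'.
by left; exists e, f.
Qed.

End TreeQuiverPaths.

(** * The isomorphism from KQ/I *)

Section TreeAlgebraIso.
Variables (K : fieldType) (n : nat) (T : bintree).
Hypothesis nT : nvert T = n.
Variables (B : pzAlgType K) (gr : nat -> B -> Prop).
Local Notation Q := (tree_quiver n T).
Local Notation r := (rlast 0 T).
Local Notation same_end := (same_end n r).
Variable E : interval_ext n r same_end gr.

Definition path_val (p : qpath Q) : B :=
  match word_deg (parrows p) with
  | Some 0 => hom E (psrc p) (ptgt p)
  | Some _ => shift E (psrc p)
  | None => 0
  end.

Lemma is_walk_path (p : qpath Q) : is_walk (psrc p) (parrows p).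
Proof. by have := valP p; rewrite qpathE. Qed.

Lemma path_same_end (p : qpath Q) : word_deg (parrows p) = Some 0%N ->
  same_end (psrc p) (ptgt p).
Proof.
move=> d0; have [le re] := walk_deg0 (is_walk_path p) d0.
by rewrite /same_end; apply/andP; split; [rewrite le /= | apply/eqP].
Qed.

Lemma path_shift_tgt (p : qpath Q) : word_deg (parrows p) = Some 1%N ->
  ptgt p = (r (psrc p)).+1 :> nat.
Proof. by move=> d1; rewrite -(walk_deg1 (is_walk_path p) d1). Qed.

Lemma path_val_src (p : qpath Q) : path_val p * hom E (psrc p) (psrc p) = path_val p.
Proof.
rewrite /path_val; case d: (word_deg (parrows p)) => [[|k]|]; last exact: mul0r.
  by apply: homM; [apply: same_end_refl | apply: path_same_end].
exact/shift_hom/same_end_refl.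
Qed.

Lemma path_val_tgt (p : qpath Q) : hom E (ptgt p) (ptgt p) * path_val p = path_val p.
Proof.
rewrite /path_val; case d: (word_deg (parrows p)) => [[|k]|]; last exact: mulr0.
  by apply: homM; [apply: path_same_end | apply: same_end_refl].
have {}d : word_deg (parrows p) = Some 1%N.
  by have := word_deg_le1 d; case: k d.
by rewrite hom_shift ?eqxx //; [apply: path_shift_tgt | apply: same_end_refl].
Qed.

Lemma path_val_comp (p p' s : qpath Q) :
  pcomp p p' = Some s -> path_val s = path_val p * path_val p'.
Proof.
move=> ps; have [pt _] := iffLR (pcompE _ _ _) ps.
have ep := path_val_src p; have := path_val_tgt p'; rewrite pt.
rewrite {1 3}/path_val (pcomp_arrows ps) (pcomp_src ps) (pcomp_tgt ps) word_deg_cat.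
case d': (word_deg (parrows p')) => [[|k']|] _; last by rewrite /path_val d' mulr0.
  have s' := path_same_end d'; rewrite pt in s'.
  rewrite /path_val d' pt; case d: (word_deg (parrows p)) => [[|k]|].
  - by rewrite homM //; apply: path_same_end.
  - by rewrite shift_hom.
  - by rewrite mul0r.
have := word_deg_le1 d'; case: k' d' => // d' _.
have := path_shift_tgt d'; rewrite /path_val d' pt => st.
case pE: (parrows p) => [|a w].
  have -> : ptgt p = psrc p by rewrite /ptgt pE.
  by rewrite /= hom_shift ?eqxx //; apply: same_end_refl.
rewrite -pE; case d: (word_deg (parrows p)) => [[|k]|]; last by rewrite mul0r.
  rewrite hom_shift ?ifN //; last exact: path_same_end.
  (* A nontrivial path of f arrows strictly lowers the label, and then [hom_shift] gives 0: this is
     the relation f eps = 0. *)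
  have lt : (ptgt p < psrc p)%N.
    by apply: walk_deg0_lt (is_walk_path p) d _; rewrite pE.
  by apply/eqP => e; rewrite e ltnn in lt.
by rewrite shift_shift.
Qed.

(** The idempotents at the end of p' and at the start of p can be inserted between the factors, and
    they are orthogonal. *)
Lemma path_val_none (p p' : qpath Q) : pcomp p p' = None -> path_val p * path_val p' = 0.
Proof.
move=> ps; rewrite -path_val_src -(path_val_tgt p') mulrA -[_ * _ * hom _ _ _]mulrA.
rewrite hom_orth ?mulr0 ?mul0r // => e.
by have [s] := @pcomp_ex Q p p' (esym e); rewrite ps.
Qed.

Lemma path_val_sum1 : \sum_v path_val (ptriv v) = 1.
Proof. by rewrite -(hom_sum1 E). Qed.

Definition tree_morph : {rmorphism pathalg K Q -> B} :=
  path_morph path_val_sum1 path_val_comp path_val_none.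

Lemma tree_morph_rel z : tree_rel K n T z -> tree_morph z = 0.
Proof.
have M p p' : tree_morph (pelt K p * pelt K p') = path_val p * path_val p'.
  by apply: etrans (rmorphM tree_morph _ _) _; congr (_ * _); exact: path_ext_elt.
case=> [[e [f [ef ->]]]|[e [e' [ee' ->]]]]; apply: etrans (M _ _) _.
  have [s sE] := @pcomp_ex Q (parr (inr f : qarr Q)) (parr (inl e : qarr Q)) ef.
  by rewrite -(path_val_comp sE) /path_val (pcomp_arrows sE).
exact: shift_shift.
Qed.

Lemma path_val_gr p : gr (pdeg tree_deg p) (path_val p).
Proof.
rewrite /path_val; case d: (word_deg (parrows p)) => [[|k]|]; last exact: gr_zero E _.
  by rewrite /pdeg (word_deg_sum d); apply: gr_hom.
have := word_deg_le1 d; case: k d => // d _.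
by rewrite /pdeg (word_deg_sum d); apply: gr_shift.
Qed.

Lemma gr_sum k (I : Type) (s : seq I) (F : I -> B) (C : pred I) :
  (forall i, C i -> gr k (F i)) -> gr k (\sum_(i <- s | C i) F i).
Proof.
by move=> H; elim/big_ind: _ => //; [exact: gr_zero E k | exact: gr_add E k].
Qed.

Lemma tree_morph_gr k x : pathalg_gr tree_deg k x -> gr k (tree_morph x).
Proof.
move=> xk; rewrite /= /path_ext big_seq; apply: gr_sum => p /xk <-.
by apply: (gr_scal E); apply: path_val_gr.
Qed.

Lemma pathalg_gr_sum k (I : Type) (s : seq I) (c : I -> K) (p : I -> qpath Q) :
  (forall i, c i <> 0 -> pdeg tree_deg (p i) = k) ->
  pathalg_gr tree_deg k (\sum_(i <- s) c i *: pelt K (p i)).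
Proof.
move=> H t ts; have [//|/eqP ne] := eqVneq (pdeg tree_deg t) k; move: ts.
rewrite -mcoeff_neq0 raddf_sum big1 ?eqxx // => i _ /=; rewrite mcoeffZ mcoeffU.
case: eqP => [e|_]; last by rewrite mulr0.
by have [->|/eqP /H] := eqVneq (c i) 0; rewrite ?mul0r // e => /ne.
Qed.

Lemma tree_morph_gr_surj k u : gr k u ->
  exists2 x, pathalg_gr tree_deg k x & tree_morph x = u.
Proof.
have phi_sum (I : Type) (s : seq I) (c : I -> K) (p : I -> qpath Q) :
    tree_morph (\sum_(i <- s) c i *: pelt K (p i)) =
    \sum_(i <- s) scal (c i) * path_val (p i).
  rewrite raddf_sum; apply: eq_bigr => i _.
  by rewrite [LHS](path_ext_scal path_val) [X in _ * X]path_ext_elt.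
case: k => [|[|k]].
- move=> /(gr0_span E) [c [cP ->]].
  have H (t : 'I_n * 'I_n) : exists p : qpath Q, c t <> 0 ->
      [/\ psrc p = t.1, ptgt p = t.2 & word_deg (parrows p) = Some 0%N].
    have [/cP /andP [/andP [le _] /eqP re]|c0] := pselect (c t <> 0); last first.
      by exists (ptriv (t.1 : qvert Q)).
    by have [p pP] := path_deg0 nT le re; exists p.
  pose p t := projT1 (cid (H t)).
  have pP t : c t <> 0 -> _ := projT2 (cid (H t)).
  exists (\sum_t c t *: pelt K (p t)).
    by apply: pathalg_gr_sum => t /pP [_ _ d]; apply: word_deg_sum.
  rewrite phi_sum; apply: eq_bigr => t _.
  have [->|/eqP /pP [s e d]] := eqVneq (c t) 0; first by rewrite rmorph0 !mul0r.
  by rewrite /path_val d s e.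
- move=> /(gr1_span E) [c [cP ->]].
  have H (t : 'I_n) : exists p : qpath Q, c t <> 0 ->
      psrc p = t /\ word_deg (parrows p) = Some 1%N.
    have [/cP lt|c0] := pselect (c t <> 0); last by exists (ptriv (t : qvert Q)).
    by have [p pP] := path_deg1 nT lt; exists p.
  pose p t := projT1 (cid (H t)).
  have pP t : c t <> 0 -> _ := projT2 (cid (H t)).
  exists (\sum_t c t *: pelt K (p t)).
    by apply: pathalg_gr_sum => t /pP [_ d]; apply: word_deg_sum.
  rewrite phi_sum; apply: eq_bigr => t _.
  have [->|/eqP /pP [s d]] := eqVneq (c t) 0; first by rewrite rmorph0 !mul0r.
  by rewrite /path_val d s.
move=> /(gr_ge2 E) ->; exists 0; last exact: rmorph0.
by move=> p; rewrite msupp0 in_fset0.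
Qed.

Lemma tree_morph_surj u : exists x, tree_morph x = u.
Proof.
move: u; apply: (gr_ind E (S := fun u => exists x, tree_morph x = u))
  => [|u v [x <-] [y <-]|k u /tree_morph_gr_surj [x _ <-]].
- by exists 0; rewrite rmorph0.
- by exists (x + y); rewrite rmorphD.
- by exists x.
Qed.

(** The coefficients of x are sorted by degree and fed to [hom_shift_free]. Each resulting sum has
    at most one nonzero term, since an admissible path is fixed by its degree and its ends, in
    degree 1 by its source alone; so only paths in the ideal remain. *)
Lemma tree_morph_ker x : tree_morph x = 0 -> x \in ideal_gen (tree_rel K n T).
Proof.
move=> x0.
pose c k (p : qpath Q) := if word_deg (parrows p) == Some k then mcoeff p x else 0.
have [||H0 H1] := @hom_shift_free _ _ _ _ _ _ E _ (msupp x) (c 0%N) (c 1%N)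
    (@psrc Q) (@ptgt Q).
- by move=> p; rewrite /c; case: eqP => // /path_same_end.
- rewrite -big_split -[RHS]x0 /= /path_ext; apply: eq_bigr => p _ /=.
  rewrite /c /path_val; case d: (word_deg (parrows p)) => [[|k]|] /=.
  + by rewrite rmorph0 mul0r addr0.
  + have := word_deg_le1 d; case: k d => // d _.
    by rewrite rmorph0 mul0r add0r.
  + by rewrite rmorph0 !mul0r mulr0 addr0.
have x_good p k : word_deg (parrows p) = Some k -> mcoeff p x = 0.
  move=> d; have [px|/mcoeff_outdom //] := boolP (p \in msupp x).
  have := word_deg_le1 d; case: k d => [|[|//]] d _.
    have := H0 _ _ (path_same_end d); rewrite (big_rem p) //= !eqxx.
    rewrite {1}/c d eqxx big1_seq ?addr0 // => p' /andP [/andP [/eqP s /eqP t]].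
    rewrite mem_rem_uniq ?fset_uniq // inE /c => /andP [ne _].
    by case: eqP => // d'; case/eqP: ne; apply: good_path_inj s t d' d.
  have lt : ((r (psrc p)).+1 < n)%N by rewrite -path_shift_tgt.
  have := H1 _ lt; rewrite (big_rem p) //= eqxx.
  rewrite {1}/c d eqxx big1_seq ?addr0 // => p' /andP [/eqP s].
  rewrite mem_rem_uniq ?fset_uniq // inE /c => /andP [ne _].
  case: eqP => // d'; case/eqP: ne; apply: (good_path_inj s _ d' d).
  by apply: val_inj; rewrite /= !path_shift_tgt // s.
rewrite (pathalgE x); apply: rpred_sum => p _.
case d: (word_deg (parrows p)) => [k|]; first by rewrite (x_good p k) // scale0r rpred0.
by rewrite -pathalg_scalE; apply/ideal_genMl/bad_path.
Qed.

Lemma tree_algebra_iso : graded_alg_iso (A := quotalg (tree_rel K n T)) (B := B)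
  (quot_gr tree_deg (tree_rel K n T)) gr.
Proof.
pose f := quot_morph tree_morph_rel.
have fE x : f (qproj _ x) = tree_morph x := quot_mapE tree_morph_rel x.
have f_inj : injective f.
  move=> u v; have [x ->] := qproj_surj u; have [y ->] := qproj_surj v.
  rewrite !fE => e; apply/qproj_eq/tree_morph_ker.
  by rewrite rmorphB e subrr.
have f_surj v : exists u, f u = v.
  by have [x <-] := tree_morph_surj v; exists (qproj _ x).
exists f; split=> [|c|k u].
- pose h v := projT1 (cid (f_surj v)).
  have hK v : f (h v) = v by exact: projT2 (cid (f_surj v)).
  by exists h => // u; apply: f_inj; rewrite hK.
- by rewrite [LHS]fE; apply: (path_ext_alg path_val_sum1 path_val_comp path_val_none).
(* Conversely, a homogeneous value has a homogeneous preimage, whose class is u by injectivity. *)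
split=> [[x [xk ->]]|/tree_morph_gr_surj [x xk xE]].
  by rewrite fE; exact: tree_morph_gr xk.
by exists x; split=> //; apply: f_inj; rewrite fE xE.
Qed.

End TreeAlgebraIso.

(** * The simple modules of A_n and the conclusion *)

Lemma simple_mod_vertex (K : fieldType) (n : nat) (j : 'I_n) :
  simple_vertex (lpath_basis K n) j (@simple_mod K (linear_quiver n) j : fdMod (An K n)).
Proof.
have co (a : An K n) : lcoef a j j = mcoeff (@ptriv (linear_quiver n) j) a.
  exact: (@lcoef_path K n a (@ptriv (linear_quiver n) j)).
have actE (a : An K n) (x : @simple_mod K (linear_quiver n) j) :
  a *: x = lcoef a j j * (x : K) :> K by rewrite co.
have scalE (c : K) : lcoef (scal c : An K n) j j = c.
  rewrite -[scal c]mulr1 [LHS](coefZ (lpath_basis K n)).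
  by rewrite (coef1 (lpath_basis K n)) eqxx ltn_ord mulr1.
exists (1 : K); split=> [/eqP|a|y]; first by rewrite oner_eq0.
  by rewrite [LHS]actE [RHS]actE scalE.
by exists y; rewrite [RHS]actE scalE mulr1.
Qed.

Theorem theorem15 (K : closedFieldType) (n : nat) (T : bintree)
    (hT : nvert T = n)
    (D : 'I_n -> fdMod (An K n)) (hD : forall i : 'I_n, is_standard T i (D i))
    (Delta : fdMod (An K n)) (hDelta : is_direct_sum D Delta)
    (P : resolution Delta) :
  graded_alg_iso (A := quotalg (tree_rel K n T)) (B := ext P)
    (quot_gr tree_deg (tree_rel K n T)) (ext_gr P).
Proof.
pose q := lpath_basis K n; pose r := rlast 0 T.
have r_bound i : (i < n)%N -> (i <= r i < n)%N.
  by move=> i_n; have := @rlast_bounds 0 T i; rewrite hT => /(_ i_n).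
have r_nested i j : (i < n)%N -> (i <= j <= r i)%N -> (r j <= r i)%N.
  by move=> i_n; apply: rlast_nested; rewrite hT.
have tree_leE (i j : 'I_n) : (i <= j)%N -> tree_le T j i = (j <= r i)%N.
  rewrite /tree_le leq_eqVlt => /orP [/eqP ij|ij].
    by rewrite -ij eqxx; have /andP [-> _] := r_bound i (ltn_ord i).
  by rewrite (gtn_eqF ij) /= [LHS]is_below_gt //; apply: tree_label hT i.
have [||g [gS gE]] := sum_generator (q := q) (r := r) _ hDelta.
- by move=> i; apply: r_bound.
- move=> i; have [P' [c [p [pc lq]]]] := hD i.
  exact: (standard_generator (@simple_mod_vertex K n) (r_bound i (ltn_ord i))
    (tree_leE i) pc lq).
have [pi piE] := res_proj P 0 (regular_mod q) Delta (orbit_map g) (res_aug P) gS.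
have [y yE] := res_aug_surj P g.
have z_ex l : exists z : P 1, (l < n)%N -> res_d P 0 z = q l (r l).+1 *: y.
  have [ln|_] := boolP (l < n)%N; last by exists 0.
  have /res_exact0 [z zE] : res_aug P (q l (r l).+1 *: y) = 0; last by exists z.
  rewrite linearZ /= yE; apply/gE => i k i_n kr; rewrite coef_elt.
  by case: eqP => //= li; case: eqP => //= lk; rewrite -lk li ltnn in kr.
have pi_lin a u v : pi (a *: u + v) = a * pi u + pi v by rewrite linearP.
exact: (tree_algebra_iso hT (standard_ext r_bound r_nested gS gE pi_lin piE yE
  (fun l => projT2 (cid (z_ex l))))).
Qed.
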